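(* Let $(E_1,\langle\cdot,\cdot\rangle_1,\rho_1,\diamond_1)$ and $(E_2,\langle\cdot,\cdot\rangle_2,\rho_2,\diamond_2)$ be Courant algebroids over the same manifold $M$, and let $\overrightarrow\nabla:\Gamma(E_1)\otimes\Gamma(E_2)\to\Gamma(E_2)$ be an $E_1$-connection on $E_2$ and $\overleftarrow\nabla:\Gamma(E_2)\otimes\Gamma(E_1)\to\Gamma(E_1)$ an $E_2$-connection on $E_1$, preserving the fibrewise metrics and satisfying $\overrightarrow\nabla_{\mathcal D_1f}\beta=0$ and $\overleftarrow\nabla_{\mathcal D_2f}b=0$ for all $f\in C^\infty(M)$, $b\in\Gamma(E_1)$, $\beta\in\Gamma(E_2)$. On $E=E_1\oplus E_2$ consider the inner product $\langle a\oplus\alpha,b\oplus\beta\rangle=\langle a,b\rangle_1+\langle\alpha,\beta\rangle_2$, the anchor $\rho(a\oplus\alpha)=\rho_1(a)+\rho_2(\alpha)$ and the bracket $$(a\oplus\alpha)\diamond(b\oplus\beta)=\big(a\diamond_1b+\overleftarrow\nabla_\alpha b-\overleftarrow\nabla_\beta a+\mho(\alpha,\beta)+\tfrac12\mathcal D_1\langle\alpha,\beta\rangle_2\big)\oplus\big(\alpha\diamond_2\beta+\overrightarrow\nabla_a\beta-\overrightarrow\nabla_b\alpha+\Omega(a,b)+\tfrac12\mathcal D_2\langle a,b\rangle_1\big).$$ Then for all $\phi,\psi\in\Gamma(E)$, $f\in C^\infty(M)$: $\phi\diamond(f\psi)=\rho(\phi)[f]\psi+f(\phi\diamond\psi)$,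 $\phi\diamond\phi=\frac12\rho^*d\langle\phi,\phi\rangle$, and $\rho(\phi)\langle\psi,\psi\rangle=2\langle\phi\diamond\psi,\psi\rangle$. Moreover, the Jacobi identity $\phi\diamond(\psi_1\diamond\psi_2)=(\phi\diamond\psi_1)\diamond\psi_2+\psi_1\diamond(\phi\diamond\psi_2)$ for all $\phi,\psi_1,\psi_2\in\Gamma(E)$ is equivalent to the following group of properties, for all $a,a_i\in\Gamma(E_1)$, $\alpha,\alpha_i\in\Gamma(E_2)$: (1) $\overleftarrow\nabla_\alpha(a_1\diamond_1a_2)-(\overleftarrow\nabla_\alpha a_1)\diamond_1a_2-a_1\diamond_1(\overleftarrow\nabla_\alpha a_2)-\overleftarrow\nabla_{\overrightarrow\nabla_{a_2}\alpha}a_1+\overleftarrow\nabla_{\overrightarrow\nabla_{a_1}\alpha}a_2=-\mho\big(\alpha,\Omega(a_1,a_2)+\tfrac12\mathcal D_2\langle a_1,a_2\rangle_1\big)-\tfrac12\mathcal D_1\big\langle\alpha,\Omega(a_1,a_2)+\tfrac12\mathcal D_2\langle a_1,a_2\rangle_1\big\rangle_2$; (2) $\overrightarrow\nabla_a(\alpha_1\diamond_2\alpha_2)-(\overrightarrow\nabla_a\alpha_1)\diamond_2\alpha_2-\alpha_1\diamond_2(\overrightarrow\nabla_a\alpha_2)-\overrightarrow\nabla_{\overleftarrow\nabla_{\alpha_2}a}\alpha_1+\overrightarrow\nabla_{\overleftarrow\nabla_{\alpha_1}a}\alpha_2=-\Omega\big(a,\mho(\alpha_1,\alpha_2)+\tfrac12\mathcal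 D_1\langle\alpha_1,\alpha_2\rangle_2\big)-\tfrac12\mathcal D_2\big\langle a,\mho(\alpha_1,\alpha_2)+\tfrac12\mathcal D_1\langle\alpha_1,\alpha_2\rangle_2\big\rangle_1$; (3) $\overrightarrow R+\overleftarrow R=0$; (4) $\overleftarrow\nabla_{\Omega(a_1,a_2)}a_3+\text{c.p.}=0$; (5) $\overrightarrow\nabla_{\mho(\alpha_1,\alpha_2)}\alpha_3+\text{c.p.}=0$, where c.p. denotes the cyclic permutations of the indices.
   Context: A Courant algebroid is a real vector bundle $E\to M$ with a fibrewise symmetric nondegenerate bilinear form $\langle\cdot,\cdot\rangle$, an $\mathbb R$-bilinear operation $\diamond$ on $\Gamma(E)$ (Dorfman bracket) and a bundle map $\rho:E\to TM$ (anchor) such that for all $\phi,\psi,\psi_1,\psi_2\in\Gamma(E)$, $f\in C^\infty(M)$: $\phi\diamond(\psi_1\diamond\psi_2)=(\phi\diamond\psi_1)\diamond\psi_2+\psi_1\diamond(\phi\diamond\psi_2)$; $\phi\diamond(f\psi)=\rho(\phi)[f]\psi+f(\phi\diamond\psi)$; $\phi\diamond\phi=\frac12\rho^*d\langle\phi,\phi\rangle$; $\rho(\phi)\langle\psi,\psi\rangle=2\langle\phi\diamond\psi,\psi\rangle$, where $\rho^*:T^*M\to E^*\cong E$ uses $\langle\cdot,\cdot\rangle$. Put $\mathcal D=\rho^*d$, and $\mathcal D_k=\rho_k^*d:C^\infty(M)\to\Gamma(E_k)$ for $E_k$, i.e. $\langle\mathcal D_kf,a\rangle_k=\rho_k(a)[f]$.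 For an anchored bundle $(E,\rho)$ an $E$-connection on a vector bundle $V$ is an $\mathbb R$-bilinear $\nabla:\Gamma(E)\otimes\Gamma(V)\to\Gamma(V)$ with $\nabla_{f\psi}v=f\nabla_\psi v$ and $\nabla_\psi(fv)=(\rho(\psi)[f])v+f\nabla_\psi v$. Preserving the metrics means $\rho_2(\alpha)\langle a,b\rangle_1=\langle\overleftarrow\nabla_\alpha a,b\rangle_1+\langle a,\overleftarrow\nabla_\alpha b\rangle_1$ and $\rho_1(a)\langle\alpha,\beta\rangle_2=\langle\overrightarrow\nabla_a\alpha,\beta\rangle_2+\langle\alpha,\overrightarrow\nabla_a\beta\rangle_2$. The skew-symmetric maps $\Omega:\wedge^2\Gamma(E_1)\to\Gamma(E_2)$ and $\mho:\wedge^2\Gamma(E_2)\to\Gamma(E_1)$ are defined by $\langle\gamma,\Omega(a,b)\rangle_2=\frac12(\langle\overleftarrow\nabla_\gamma a,b\rangle_1-\langle a,\overleftarrow\nabla_\gamma b\rangle_1)$ for all $\gamma\in\Gamma(E_2)$ and $\langle c,\mho(\alpha,\beta)\rangle_1=\frac12(\langle\overrightarrow\nabla_c\alpha,\beta\rangle_2-\langle\alpha,\overrightarrow\nabla_c\beta\rangle_2)$ for all $c\in\Gamma(E_1)$. Curvatures: $\overrightarrow R(a,b)\alpha=\overrightarrow\nabla_a\overrightarrow\nabla_b\alpha-\overrightarrow\nabla_b\overrightarrow\nabla_a\alpha-\overrightarrow\nabla_{a\diamond_1b}\alpha$ and $\overleftarrow R(\alpha,\beta)a=\overleftarrow\nabla_\alpha\overleftarrow\nabla_\beta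 a-\overleftarrow\nabla_\beta\overleftarrow\nabla_\alpha a-\overleftarrow\nabla_{\alpha\diamond_2\beta}a$. Both are regarded as sections of $\wedge^2E_1^*\otimes\wedge^2E_2^*$ via the metrics, namely as $(a,b,\alpha,\beta)\mapsto\langle\overrightarrow R(a,b)\alpha,\beta\rangle_2$ and $(a,b,\alpha,\beta)\mapsto\langle\overleftarrow R(\alpha,\beta)a,b\rangle_1$; (3) says their sum is zero. *)

(* Defs.v *)
From HB Require Import structures.
From mathcomp Require Import all_boot all_order all_algebra.
From mathcomp Require Import all_classical all_reals all_analysis.

Set Implicit Arguments.
Unset Strict Implicit.
Unset Printing Implicit Defensive.

Import Order.TTheory GRing.Theory Num.Theory.
Import numFieldNormedType.Exports.

Local Open Scope classical_set_scope.
Local Open Scope ring_scope.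

(* [Ck k U f]: all iterated directional derivatives of [f] of order at most [k]
   exist and are continuous on [U]; only meant for open sets [U]. *)
Fixpoint Ck (R : realType) (n k : nat) (U : set 'rV[R]_n)
    (f : 'rV[R]_n -> R) : Prop :=
  (forall x, U x -> {for x, continuous f}) /\
  if k is k'.+1 then
    forall v, (forall x, U x -> derivable f x v) /\
              Ck k' U (fun x => 'D_v f x)
  else True.

Definition Cinfty (R : realType) (n : nat) (U : set 'rV[R]_n)
    (f : 'rV[R]_n -> R) : Prop := forall k, Ck k U f.

Section CkTheory.
Variables (R : realType) (n : nat) (U : set 'rV[R]_n).
Implicit Types f g : 'rV[R]_n -> R.

Lemma CkW k f : Ck k.+1 U f -> Ck k U f.
Proof.
elim: k f => [|k IH] f [cf df]; split => // v.
by have [f1 f2] := df v; split => //; exact: IH.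
Qed.

Lemma CkS k (V : set 'rV[R]_n) f : V `<=` U -> Ck k U f -> Ck k V f.
Proof.
move=> VU; elim: k f => [|k IH] f [cf df]; split => //; try by move=> x /VU/cf.
by move=> v; have [f1 f2] := df v; split=> [x /VU/f1//|]; exact: IH.
Qed.

Lemma Ck_local k f :
  (forall x, U x -> exists2 V : set 'rV[R]_n, V x & Ck k V f) -> Ck k U f.
Proof.
elim: k f => [|k IH] f loc; split => //.
- by move=> x /loc[V Vx [+ _]]; apply.
- by move=> x /loc[V Vx [+ _]]; apply.
move=> v; split=> [x /loc[V Vx [_ /(_ v)[+ _]]]|]; first exact.
by apply: IH => x /loc[V Vx [_ /(_ v)[_ ?]]]; exists V.
Qed.

Hypothesis oU : open U.

Lemma Ck_ext k f g : (forall x, U x -> f x = g x) -> Ck k U f -> Ck k U g.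
Proof.
elim: k f g => [|k IH] f g fg [cf df].
  split => // x Ux; have nfg : \forall y \near x, f y = g y.
    by apply: filterS (open_nbhs_nbhs (conj oU Ux)).
  rewrite /prop_for /continuous_at -(fg _ Ux).
  exact: cvg_trans (near_eq_cvg nfg) (cf _ Ux).
have nfg x : U x -> \forall y \near x, f y = g y.
  by move=> Ux; apply: filterS (open_nbhs_nbhs (conj oU Ux)).
split.
  move=> x Ux; rewrite /prop_for /continuous_at -(fg _ Ux).
  exact: cvg_trans (near_eq_cvg (nfg _ Ux)) (cf _ Ux).
move=> v; have [f1 f2] := df v; split=> [x Ux|].
  exact: near_eq_derivable (nfg x Ux) (f1 _ Ux).
by apply: IH f2 => x Ux; apply: near_eq_derive; exact: nfg.
Qed.

Lemma Ck_cst k (c : R) : Ck k U (cst c).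
Proof.
elim: k c => [|k IH] c; split => //; try by move=> x _; exact: cst_continuous.
move=> v; split=> [x _|]; first exact: derivable_cst.
by apply: Ck_ext (IH 0) => x _; exact/esym/derive_cst.
Qed.

Lemma CkD k f g : Ck k U f -> Ck k U g -> Ck k U (fun x => f x + g x).
Proof.
elim: k f g => [|k IH] f g [cf df] [cg dg]; split => //.
- by move=> x Ux; apply: continuousD; [exact: cf|exact: cg].
- by move=> x Ux; apply: continuousD; [exact: cf|exact: cg].
move=> v; have [f1 f2] := df v; have [g1 g2] := dg v; split=> [x Ux|].
  by apply: derivableD; [exact: f1|exact: g1].
apply: Ck_ext (IH _ _ f2 g2) => x Ux.
by rewrite [RHS](deriveD (f1 _ Ux) (g1 _ Ux)).
Qed.

Lemma CkM k f g : Ck k U f -> Ck k U g -> Ck k U (fun x => f x * g x).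
Proof.
elim: k f g => [|k IH] f g /[dup] fk [cf df] /[dup] gk [cg dg]; split => //.
- by move=> x Ux; apply: continuousM; [exact: cf|exact: cg].
- by move=> x Ux; apply: continuousM; [exact: cf|exact: cg].
move=> v; have [f1 f2] := df v; have [g1 g2] := dg v; split=> [x Ux|].
  by apply: derivableM; [exact: f1|exact: g1].
apply: Ck_ext (CkD (IH _ _ (CkW fk) g2) (IH _ _ (CkW gk) f2)) => x Ux.
by rewrite [RHS](deriveM (f1 _ Ux) (g1 _ Ux)).
Qed.

End CkTheory.

Record chart (R : realType) (n : nat) (T : topologicalType) := Chart {
  chart_dom : set T;
  chart_cod : set 'rV[R]_n;
  chart_map :> T -> 'rV[R]_n;
  chart_inv : 'rV[R]_n -> T;
  open_chart_dom : open chart_dom;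
  open_chart_cod : open chart_cod;
  chart_mapP : forall x, chart_dom x -> chart_cod (chart_map x);
  chart_invP : forall y, chart_cod y -> chart_dom (chart_inv y);
  chart_mapK : forall x, chart_dom x -> chart_inv (chart_map x) = x;
  chart_invK : forall y, chart_cod y -> chart_map (chart_inv y) = y;
  chart_map_continuous :
    forall x, chart_dom x -> {for x, continuous chart_map};
  chart_inv_continuous :
    forall y, chart_cod y -> {for y, continuous chart_inv}
}.

Definition smooth_transition (R : realType) (n : nat) (T : topologicalType)
    (c d : chart R n T) : Prop :=
  forall i : 'I_n,
    Cinfty (chart_cod c `&` chart_inv c @^-1` chart_dom d)
           (fun y => d (chart_inv c y) ord0 i).

Record manifold (R : realType) (n : nat) := Manifold {
  mfd_space :> topologicalType;
  atlas : set (chart R n mfd_space);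
  mfd_hausdorff : hausdorff_space mfd_space;
  mfd_second_countable : @second_countable mfd_space;
  atlas_cover : forall x, exists2 c, atlas c & chart_dom c x;
  atlas_compatible :
    forall c d, atlas c -> atlas d -> smooth_transition c d
}.

Section SmoothOn.
Variables (R : realType) (n : nat) (M : manifold R n).
Implicit Types (U V : set M) (f g : M -> R).

(* Only meant for open [U]. *)
Definition smooth_on U f : Prop :=
  forall c, @atlas R n M c ->
    Cinfty (chart_cod c `&` chart_inv c @^-1` U) (f \o chart_inv c).

Lemma open_chart_preimage (c : chart R n M) U :
  open U -> open (chart_cod c `&` chart_inv c @^-1` U).
Proof.
move=> oU; rewrite openE => y [cy Uy].
have nc : nbhs y (chart_cod c).
  by apply: open_nbhs_nbhs; split => //; exact: open_chart_cod.
have nU : nbhs (chart_inv c y) U by exact: open_nbhs_nbhs.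
exact: filterI nc (chart_inv_continuous cy nU).
Qed.

Lemma smooth_onS U V f : V `<=` U -> smooth_on U f -> smooth_on V f.
Proof.
by move=> VU fU c cM m; apply: CkS (fU c cM m) => y [yc /VU yU]; split.
Qed.

Lemma smooth_on_local U f :
  (forall x, U x -> exists2 V : set M, V x & smooth_on V f) -> smooth_on U f.
Proof.
move=> loc c cM k; apply: Ck_local => y [cy /loc[V Vy fV]].
by exists (chart_cod c `&` chart_inv c @^-1` V) => //; exact: fV.
Qed.

Lemma smooth_on_cst U (k : R) : open U -> smooth_on U (cst k).
Proof. by move=> oU c _ m; apply: Ck_cst; exact: open_chart_preimage. Qed.

Lemma smooth_on_ext U f g : open U -> (forall x, U x -> f x = g x) ->
  smooth_on U f -> smooth_on U g.
Proof.
move=> oU fg fU c cM m; apply: Ck_ext (fU c cM m) => [|y [_ /fg//]].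
exact: open_chart_preimage.
Qed.

Lemma smooth_onD U f g : open U ->
  smooth_on U f -> smooth_on U g -> smooth_on U (fun x => f x + g x).
Proof.
move=> oU fU gU c cM m.
by apply: CkD; [exact: open_chart_preimage|exact: fU|exact: gU].
Qed.

Lemma smooth_onM U f g : open U ->
  smooth_on U f -> smooth_on U g -> smooth_on U (fun x => f x * g x).
Proof.
move=> oU fU gU c cM m.
by apply: CkM; [exact: open_chart_preimage|exact: fU|exact: gU].
Qed.

Lemma smooth_onN U f : open U -> smooth_on U f -> smooth_on U (fun x => - f x).
Proof.
move=> oU fU; under eq_fun do rewrite -mulN1r.
by apply: smooth_onM => //; exact: smooth_on_cst.
Qed.

Definition smooth_pred : {pred M -> R} := fun f => `[< smooth_on setT f >].

Lemma smooth_predP f : reflect (smooth_on setT f) (f \in smooth_pred).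
Proof. exact: asboolP. Qed.

Lemma smooth_subring_closed : subring_closed smooth_pred.
Proof.
split.
- by apply/smooth_predP; apply: smooth_on_cst; exact: openT.
- move=> f g /smooth_predP fM /smooth_predP gM; apply/smooth_predP.
  by apply: smooth_onD (smooth_onN _ _) => //; exact: openT.
- move=> f g /smooth_predP fM /smooth_predP gM; apply/smooth_predP.
  by apply: smooth_onM => //; exact: openT.
Qed.

Record smooth_fun := SmoothFun {
  smooth_val :> M -> R;
  smooth_valP : smooth_val \in smooth_pred
}.

HB.instance Definition _ := [isSub for smooth_val].
HB.instance Definition _ := [Choice of smooth_fun by <:].
HB.instance Definition _ :=
  GRing.SubChoice_isSubComPzRing.Build (M -> R) smooth_pred smooth_fun
    smooth_subring_closed.

Definition smooth_of f (fM : smooth_on setT f) : smooth_fun :=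
  SmoothFun (introT (smooth_predP f) fM).

Definition smooth_cst (k : R) : smooth_fun := smooth_of (smooth_on_cst k openT).

End SmoothOn.

Section Tangent.
Variables (R : realType) (n : nat) (M : manifold R n) (x : M).

Definition derivation_at (X : smooth_fun M -> R^o) : Prop :=
  (forall f g, X (f + g) = X f + X g) /\
  (forall k f, X (smooth_cst M k * f) = k * X f) /\
  (forall f g, X (f * g) = X f * g x + f x * X g).

Definition derivation_pred : {pred smooth_fun M -> R^o} :=
  fun X => `[< derivation_at X >].

Lemma derivation_submod_closed : submod_closed derivation_pred.
Proof.
split.
  apply/asboolP; split; [|split] => *.
  - by rewrite -[LHS]/(0 : R) -[RHS]/(0 + 0 : R) addr0.
  - by rewrite -[LHS]/(0 : R) -[X in _ = _ * X]/(0 : R) mulr0.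
  - rewrite -[LHS]/(0 : R) -[X in _ = X * _ + _ * _]/(0 : R).
    by rewrite -[X in _ = _ * _ + _ * X]/(0 : R) mulr0 mul0r addr0.
move=> a X Y /asboolP[XD [XZ XM]] /asboolP[YD [YZ YM]].
have E h : (a *: X + Y) h = a * X h + Y h by [].
apply/asboolP; split; [|split] => [f g|k f|f g]; rewrite !E.
- by rewrite XD YD mulrDr addrACA.
- by rewrite XZ YZ mulrDr !mulrA [k * a]mulrC.
- by rewrite XM YM !mulrDr !mulrDl addrACA !mulrA [f x * a]mulrC.
Qed.

HB.instance Definition _ :=
  GRing.isSubmodClosed.Build R (smooth_fun M -> R^o) derivation_pred
    derivation_submod_closed.

Record tangent := Tangent {
  tangent_val :> smooth_fun M -> R^o;
  tangent_valP : tangent_val \in derivation_pred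
}.

HB.instance Definition _ := [isSub for tangent_val].
HB.instance Definition _ := [Choice of tangent by <:].
HB.instance Definition _ := [SubChoice_isSubLmodule of tangent by <:].

End Tangent.

Section Bundles.
Variables (R : realType) (n : nat) (M : manifold R n).

(* A smooth vector bundle is a family of vector spaces with a cover of its base
   by local trivializations whose transition functions are smooth; the rank may
   depend on the trivialization. *)
Record local_triv (E : M -> lmodType R) := LocalTriv {
  triv_dom : set M;
  triv_rank : nat;
  triv_map : forall x, {linear E x -> 'rV[R]_triv_rank};
  open_triv_dom : open triv_dom;
  triv_bij : forall x, triv_dom x -> bijective (triv_map x)
}.

Definition triv_compatible (E : M -> lmodType R) (s t : local_triv E) : Prop :=
  exists g : M -> 'M[R]_(triv_rank s, triv_rank t),
    (forall i j, smooth_on (triv_dom s `&` triv_dom t) (fun x => g x i j)) /\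
    (forall x, triv_dom s x -> triv_dom t x ->
       forall v : E x, triv_map t x v = triv_map s x v *m g x).

Record bundle := Bundle {
  fibre :> M -> lmodType R;
  trivs : set (local_triv fibre);
  trivs_cover : forall x, exists2 t, trivs t & triv_dom t x;
  trivs_compatible :
    forall s t, trivs s -> trivs t -> triv_compatible s t
}.

Section Sections.
Variable E : bundle.

Definition smooth_section (s : forall x, E x) : Prop :=
  forall t, trivs t -> forall i,
    smooth_on (triv_dom t) (fun x => triv_map t x (s x) ord0 i).

Record sect := Sect {
  sect_val :> forall x, E x;
  sect_valP : smooth_section sect_val
}.

Lemma sect_eqP (s t : sect) : (forall x, s x = t x) -> s = t.
Proof.
case: s t => [s sP] [t tP] /= st.
have {}st : s = t by exact: functional_extensionality_dep.
by subst t; congr Sect; exact: Prop_irrelevance.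
Qed.

HB.instance Definition _ := gen_eqMixin sect.
HB.instance Definition _ := gen_choiceMixin sect.

Lemma sect0_subproof : smooth_section (fun x => 0 : E x).
Proof.
move=> t tE i; under eq_fun do rewrite linear0 mxE.
by apply: smooth_on_cst; exact: open_triv_dom.
Qed.

Lemma sectN_subproof (s : sect) : smooth_section (fun x => - s x).
Proof.
move=> t tE i; under eq_fun do rewrite linearN mxE.
by apply: smooth_onN; [exact: open_triv_dom|exact: sect_valP].
Qed.

Lemma sectD_subproof (s u : sect) : smooth_section (fun x => s x + u x).
Proof.
move=> t tE i; under eq_fun do rewrite linearD mxE.
by apply: smooth_onD; [exact: open_triv_dom|exact: sect_valP..].
Qed.

Lemma sectZ_subproof (f : smooth_fun M) (s : sect) :
  smooth_section (fun x => f x *: s x).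
Proof.
move=> t tE i; under eq_fun do rewrite linearZ mxE.
apply: smooth_onM; [exact: open_triv_dom| |exact: sect_valP].
by apply: smooth_onS (subsetT _) _; apply/smooth_predP; exact: smooth_valP.
Qed.

Definition sect0 := Sect sect0_subproof.
Definition sectN s := Sect (sectN_subproof s).
Definition sectD s u := Sect (sectD_subproof s u).
Definition sectZ f s := Sect (sectZ_subproof f s).

Lemma sectDA : associative sectD.
Proof. by move=> *; apply: sect_eqP => x; exact: addrA. Qed.
Lemma sectDC : commutative sectD.
Proof. by move=> *; apply: sect_eqP => x; exact: addrC. Qed.
Lemma sect0D : left_id sect0 sectD.
Proof. by move=> *; apply: sect_eqP => x; exact: add0r. Qed.
Lemma sectND : left_inverse sect0 sectN sectD.
Proof. by move=> *; apply: sect_eqP => x; exact: addNr. Qed.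

HB.instance Definition _ :=
  GRing.isZmodule.Build sect sectDA sectDC sect0D sectND.

Lemma sectZA f g s : sectZ f (sectZ g s) = sectZ (f * g) s.
Proof. by apply: sect_eqP => x; exact: scalerA. Qed.
Lemma sect1Z : left_id 1 sectZ.
Proof. by move=> *; apply: sect_eqP => x; exact: scale1r. Qed.
Lemma sectZDr : right_distributive sectZ +%R.
Proof. by move=> *; apply: sect_eqP => x; exact: scalerDr. Qed.
Lemma sectZDl s : {morph sectZ^~ s : f g / f + g}.
Proof. by move=> *; apply: sect_eqP => x; exact: scalerDl. Qed.

HB.instance Definition _ :=
  GRing.Zmodule_isLmodule.Build (smooth_fun M) sect sectZA sect1Z sectZDr
    sectZDl.

End Sections.

Record metric (E : bundle) := Metric {
  metric_at : forall x, E x -> E x -> R;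
  metric_linear : forall x (k : R) (u v w : E x),
    metric_at (k *: u + v) w = k * metric_at u w + metric_at v w;
  metric_sym : forall x (u v : E x), metric_at u v = metric_at v u;
  metric_nondeg : forall x (u : E x),
    (forall v, metric_at u v = 0) -> u = 0;
  metric_smooth : forall s t : sect E,
    smooth_on setT (fun x => metric_at (s x) (t x))
}.

Lemma metric0r (E : bundle) (g : metric E) x (u : E x) : metric_at g u 0 = 0.
Proof.
have := metric_linear g 1 0 0 u; rewrite scaler0 addr0 mul1r.
move=> /(congr1 (fun z => z - metric_at g 0 u)).
by rewrite subrr addrK metric_sym => <-.
Qed.

Definition inner (E : bundle) (g : metric E) (s t : sect E) : smooth_fun M :=
  smooth_of (metric_smooth g s t).

(* T_x M is the space of derivations of C^infty(M) at x, and a vector field X is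
   smooth when X[f] is a smooth function for every smooth f; a bundle map
   E -> TM is fibrewise linear and sends smooth sections to smooth fields. *)
Record anchor (E : bundle) := Anchor {
  anchor_at : forall x, {linear E x -> tangent x};
  anchor_smooth : forall (s : sect E) (f : smooth_fun M),
    smooth_on setT (fun x => anchor_at x (s x) f)
}.

Definition anchor_der (E : bundle) (rho : anchor E) (s : sect E)
  (f : smooth_fun M) : smooth_fun M := smooth_of (anchor_smooth rho s f).

(* The section representing, through the metric, a functional on sections:
   <c, dual_sect g w> = w c for all c. Such a section is unique, and it exists
   whenever [w] is C^infty(M)-linear (the value 0 is a dummy otherwise). *)
Definition dual_sect (E : bundle) (g : metric E)
    (w : sect E -> smooth_fun M) : sect E :=
  xget 0 [set s | forall c, inner g c s = w c].

(* rho^* d f, the section with <rho^* d f, a> = rho(a)[f] for all a *)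
Definition coanchor_d (E : bundle) (g : metric E) (rho : anchor E)
    (f : smooth_fun M) : sect E :=
  dual_sect g (fun a => anchor_der rho a f).

(* The scalar 1/2 of C^infty(M), i.e. a constant function. *)
Definition smooth_half : smooth_fun M := smooth_cst M 2^-1.

(* R acts on sections through the constant functions. *)
Definition rbilinear (E F G : bundle) (b : sect E -> sect F -> sect G) : Prop :=
  (forall (k : R) s s' t,
     b (smooth_cst M k *: s + s') t = smooth_cst M k *: b s t + b s' t) /\
  (forall (k : R) s t t',
     b s (smooth_cst M k *: t + t') = smooth_cst M k *: b s t + b s t').

Record courant_data := CourantData {
  cbundle :> bundle;
  cmetric : metric cbundle;
  canchor : anchor cbundle;
  dorfman : sect cbundle -> sect cbundle -> sect cbundle
}.

Definition cD (E : courant_data) : smooth_fun M -> sect E :=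
  coanchor_d (cmetric E) (canchor E).

Definition jacobi_identity (E : courant_data) : Prop :=
  forall phi psi1 psi2 : sect E,
    dorfman phi (dorfman psi1 psi2) =
    dorfman (dorfman phi psi1) psi2 + dorfman psi1 (dorfman phi psi2).

Definition leibniz_rule (E : courant_data) : Prop :=
  forall (phi psi : sect E) (f : smooth_fun M),
    dorfman phi (f *: psi) =
    anchor_der (canchor E) phi f *: psi + f *: dorfman phi psi.

Definition symmetric_part (E : courant_data) : Prop :=
  forall phi : sect E,
    dorfman phi phi = smooth_half *: cD E (inner (cmetric E) phi phi).

Definition metric_invariance (E : courant_data) : Prop :=
  forall phi psi : sect E,
    anchor_der (canchor E) phi (inner (cmetric E) psi psi) =
    2%:R * inner (cmetric E) (dorfman phi psi) psi.

Record courant_algebroid := CourantAlgebroid {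
  courant_of :> courant_data;
  courant_bilinear : rbilinear (@dorfman courant_of);
  courant_jacobi : jacobi_identity courant_of;
  courant_leibniz : leibniz_rule courant_of;
  courant_symmetric : symmetric_part courant_of;
  courant_invariance : metric_invariance courant_of
}.

Definition is_connection (E V : bundle) (rho : anchor E)
    (nabla : sect E -> sect V -> sect V) : Prop :=
  [/\ rbilinear nabla,
      (forall (f : smooth_fun M) psi v, nabla (f *: psi) v = f *: nabla psi v) &
      (forall (f : smooth_fun M) psi v,
         nabla psi (f *: v) = anchor_der rho psi f *: v + f *: nabla psi v)].

Definition preserves_metric (E V : bundle) (rho : anchor E) (g : metric V)
    (nabla : sect E -> sect V -> sect V) : Prop :=
  forall psi u v,
    anchor_der rho psi (inner g u v) =
    inner g (nabla psi u) v + inner g u (nabla psi v).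

(* The skew map: <c, S(u, v)>_E = 1/2 (<nabla_c u, v>_V - <u, nabla_c v>_V). *)
Definition skew_map (E V : bundle) (gE : metric E) (gV : metric V)
    (nabla : sect E -> sect V -> sect V) (u v : sect V) : sect E :=
  dual_sect gE (fun c =>
    smooth_half * (inner gV (nabla c u) v - inner gV u (nabla c v))).

Definition curvature (E : courant_data) (V : bundle)
    (nabla : sect E -> sect V -> sect V) (a b : sect E) (v : sect V) : sect V :=
  nabla a (nabla b v) - nabla b (nabla a v) - nabla (dorfman a b) v.

Section DirectSum.
Variables E1 E2 : bundle.

Definition sum_fibre (x : M) : lmodType R := (E1 x * E2 x)%type.

Section SumTriv.
Variables (t1 : local_triv E1) (t2 : local_triv E2).

Definition sum_triv_map (x : M) (v : sum_fibre x) :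
    'rV[R]_(triv_rank t1 + triv_rank t2) :=
  row_mx (triv_map t1 x v.1) (triv_map t2 x v.2).

Lemma sum_triv_map_linear x : linear (@sum_triv_map x).
Proof.
by move=> k u v; rewrite /sum_triv_map !linearP scale_row_mx add_row_mx.
Qed.

HB.instance Definition _ x :=
  GRing.isLinear.Build R (sum_fibre x)
    'rV[R]_(triv_rank t1 + triv_rank t2) _ (@sum_triv_map x)
    (@sum_triv_map_linear x).

Lemma sum_triv_open : open (triv_dom t1 `&` triv_dom t2).
Proof. by apply: openI; exact: open_triv_dom. Qed.

Lemma sum_triv_bij x :
  (triv_dom t1 `&` triv_dom t2) x -> bijective (@sum_triv_map x).
Proof.
move=> [/triv_bij[h1 h1K h1K'] /triv_bij[h2 h2K h2K']].
exists (fun w => (h1 (lsubmx w), h2 (rsubmx w)) : sum_fibre x) => [[v1 v2]|w].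
  by rewrite /sum_triv_map row_mxKl row_mxKr h1K h2K.
by rewrite /sum_triv_map h1K' h2K' hsubmxK.
Qed.

Definition sum_triv : local_triv sum_fibre :=
  @LocalTriv sum_fibre (triv_dom t1 `&` triv_dom t2)
    (triv_rank t1 + triv_rank t2) (fun x => @sum_triv_map x)
    sum_triv_open sum_triv_bij.

End SumTriv.

Definition sum_trivs : set (local_triv sum_fibre) :=
  [set t | exists t1 t2, [/\ trivs t1, trivs t2 & t = sum_triv t1 t2]].

Lemma sum_trivs_cover x : exists2 t, sum_trivs t & triv_dom t x.
Proof.
have [t1 ? ?] := trivs_cover E1 x; have [t2 ? ?] := trivs_cover E2 x.
by exists (sum_triv t1 t2) => //; exists t1, t2.
Qed.

Lemma sum_trivs_compatible s t :
  sum_trivs s -> sum_trivs t -> triv_compatible s t.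
Proof.
move=> [s1 [s2 [s1E s2E ->]]] [t1 [t2 [t1E t2E ->]]].
have [g1 [g1S g1E]] := trivs_compatible s1E t1E.
have [g2 [g2S g2E]] := trivs_compatible s2E t2E.
exists (fun x => block_mx (g1 x) 0 0 (g2 x)); split => /=.
  move=> i j; case: (split_ordP i) => i' ->; case: (split_ordP j) => j' ->.
  - under eq_fun do rewrite block_mxEul.
    by apply: smooth_onS (g1S i' j') => x [[? _] [? _]].
  - under eq_fun do rewrite block_mxEur mxE.
    by apply: smooth_on_cst; apply: openI; exact: sum_triv_open.
  - under eq_fun do rewrite block_mxEdl mxE.
    by apply: smooth_on_cst; apply: openI; exact: sum_triv_open.
  - under eq_fun do rewrite block_mxEdr.
    by apply: smooth_onS (g2S i' j') => x [[_ ?] [_ ?]].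
move=> x [? ?] [? ?] v; rewrite /sum_triv_map mul_row_block !mulmx0.
by rewrite addr0 add0r g1E// g2E.
Qed.

Definition sum_bundle : bundle :=
  @Bundle sum_fibre sum_trivs sum_trivs_cover sum_trivs_compatible.

Lemma sect_pair_subproof (a : sect E1) (b : sect E2) :
  @smooth_section sum_bundle (fun x => (a x, b x)).
Proof.
move=> _ [t1 [t2 [t1E t2E ->]]] i /=.
case: (split_ordP i) => j ->; rewrite /sum_triv_map.
- under eq_fun do rewrite row_mxEl.
  by apply: smooth_onS (sect_valP a t1E j) => x [].
- under eq_fun do rewrite row_mxEr.
  by apply: smooth_onS (sect_valP b t2E j) => x [].
Qed.

Definition sect_pair (a : sect E1) (b : sect E2) : sect sum_bundle :=
  Sect (sect_pair_subproof a b).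

Lemma sect_fst_subproof (s : sect sum_bundle) :
  @smooth_section E1 (fun x => (s x).1).
Proof.
move=> t1 t1E i; apply: smooth_on_local => x t1x.
have [t2 t2E t2x] := trivs_cover E2 x.
exists (triv_dom t1 `&` triv_dom t2) => //.
have tE : sum_trivs (sum_triv t1 t2) by exists t1, t2.
have := sect_valP s tE (lshift _ i) => /=; rewrite /sum_triv_map.
by under eq_fun do rewrite row_mxEl.
Qed.

Lemma sect_snd_subproof (s : sect sum_bundle) :
  @smooth_section E2 (fun x => (s x).2).
Proof.
move=> t2 t2E i; apply: smooth_on_local => x t2x.
have [t1 t1E t1x] := trivs_cover E1 x.
exists (triv_dom t1 `&` triv_dom t2) => //.
have tE : sum_trivs (sum_triv t1 t2) by exists t1, t2.
have := sect_valP s tE (rshift _ i) => /=; rewrite /sum_triv_map.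
by under eq_fun do rewrite row_mxEr.
Qed.

Definition sect_fst (s : sect sum_bundle) : sect E1 :=
  Sect (sect_fst_subproof s).
Definition sect_snd (s : sect sum_bundle) : sect E2 :=
  Sect (sect_snd_subproof s).

Section SumMetric.
Variables (g1 : metric E1) (g2 : metric E2).

Definition sum_metric_at (x : M) (u v : sum_bundle x) : R :=
  metric_at g1 u.1 v.1 + metric_at g2 u.2 v.2.

Lemma sum_metric_linear x (k : R) (u v w : sum_bundle x) :
  sum_metric_at (k *: u + v) w = k * sum_metric_at u w + sum_metric_at v w.
Proof. by rewrite /sum_metric_at !metric_linear mulrDr addrACA. Qed.

Lemma sum_metric_sym x (u v : sum_bundle x) :
  sum_metric_at u v = sum_metric_at v u.
Proof. by rewrite /sum_metric_at metric_sym [X in _ + X]metric_sym. Qed.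

Lemma sum_metric_nondeg x (u : sum_bundle x) :
  (forall v, sum_metric_at u v = 0) -> u = 0.
Proof.
case: u => u1 u2 u0; congr pair; apply: metric_nondeg => v.
- by have := u0 (v, 0); rewrite /sum_metric_at /= metric0r addr0; exact.
- by have := u0 (0, v); rewrite /sum_metric_at /= metric0r add0r; exact.
Qed.

Lemma sum_metric_smooth (s t : sect sum_bundle) :
  smooth_on setT (fun x => sum_metric_at (s x) (t x)).
Proof.
by apply: smooth_onD openT
  (metric_smooth g1 (sect_fst s) (sect_fst t))
  (metric_smooth g2 (sect_snd s) (sect_snd t)).
Qed.

Definition sum_metric : metric sum_bundle :=
  Metric sum_metric_linear sum_metric_sym sum_metric_nondeg sum_metric_smooth.

End SumMetric.

Section SumAnchor.
Variables (rho1 : anchor E1) (rho2 : anchor E2).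

Definition sum_anchor_at (x : M) (u : sum_bundle x) : tangent x :=
  anchor_at rho1 x u.1 + anchor_at rho2 x u.2.

Lemma sum_anchor_linear x : linear (@sum_anchor_at x).
Proof.
by move=> k u v; rewrite /sum_anchor_at !linearP scalerDr addrACA.
Qed.

HB.instance Definition _ x :=
  GRing.isLinear.Build R (sum_bundle x) (tangent x) _ (@sum_anchor_at x)
    (@sum_anchor_linear x).

Lemma sum_anchor_smooth (s : sect sum_bundle) (f : smooth_fun M) :
  smooth_on setT (fun x => sum_anchor_at (s x) f).
Proof.
by apply: smooth_onD openT
  (anchor_smooth rho1 (sect_fst s) f) (anchor_smooth rho2 (sect_snd s) f).
Qed.

Definition sum_anchor : anchor sum_bundle :=
  @Anchor sum_bundle (fun x => @sum_anchor_at x) sum_anchor_smooth.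

End SumAnchor.

End DirectSum.

(* [nablar] (right arrow) is an E1-connection on E2, and [nablal] (left arrow)
   an E2-connection on E1. *)
Section CourantSum.
Variables (E1 E2 : courant_data).
Variables (nablar : sect E1 -> sect E2 -> sect E2).
Variables (nablal : sect E2 -> sect E1 -> sect E1).

Definition Omega (a b : sect E1) : sect E2 :=
  skew_map (cmetric E2) (cmetric E1) nablal a b.

Definition Mho (alpha beta : sect E2) : sect E1 :=
  skew_map (cmetric E1) (cmetric E2) nablar alpha beta.

Definition sum_dorfman (phi psi : sect (sum_bundle E1 E2)) :
    sect (sum_bundle E1 E2) :=
  let a := sect_fst phi in let alpha := sect_snd phi in
  let b := sect_fst psi in let beta := sect_snd psi in
  sect_pair
    (dorfman a b + nablal alpha b - nablal beta a + Mho alpha beta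
       + smooth_half *: cD E1 (inner (cmetric E2) alpha beta))
    (dorfman alpha beta + nablar a beta - nablar b alpha + Omega a b
       + smooth_half *: cD E2 (inner (cmetric E1) a b)).

Definition courant_sum : courant_data :=
  CourantData (sum_metric (cmetric E1) (cmetric E2))
    (sum_anchor (canchor E1) (canchor E2)) sum_dorfman.

End CourantSum.

End Bundles.

Arguments smooth_half {R n} M.

(* Main.v *)
Require Import Defs.
From mathcomp Require Import all_boot all_order all_algebra.
From mathcomp Require Import all_classical all_reals all_analysis.
From mathcomp Require Import ring lra.

Set Implicit Arguments.
Unset Strict Implicit.
Unset Printing Implicit Defensive.

Import Order.TTheory GRing.Theory Num.Theory.
Import numFieldNormedType.Exports.

Local Open Scope classical_set_scope.
Local Open Scope ring_scope.

(** The idea is to make the bracket on E1 (+) E2 uniform, after which every claim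
is a short computation. Put

  T(a, b) = Omega(a, b) + 1/2 D2 <a, b>,
  S(al, be) = Mho(al, be) + 1/2 D1 <al, be>.

Because the connections preserve the metrics, the two halves merge and T and S
are characterized by <ga, T(a, b)> = <nablal_ga a, b> and
<c, S(al, be)> = <nablar_c al, be> ([inner_twist]); both maps are [twist] below.
In these terms the bracket has E1-component

  a.b + nablal_al b - nablal_be a + S(al, be)

and the E2-component obtained by exchanging the roles of E1 and E2. The Leibniz
rule is then immediate, and the other two axioms are identities between inner
products ([pair_bracket_sym] and [pair_bracket_inner], both in polarized form).

For the Jacobi identity let J(p, q, r) be the defect p(qr) - (pq)r - q(pr). It is
additive in each argument, so it vanishes if and only if it vanishes on
arguments each of which lies in E1 or in E2. If q and r are orthogonal, the
three proved axioms give J(p, r, q) = - J(p, q, r), and likewise in the first two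
arguments, and if r and s are orthogonal, <J(p, q, r), s> = - <r, J(p, q, s)>. As
E1 and E2 are orthogonal, all types with two arguments in E1 and one in E2 reduce
to J(al, a1, a2). Its E1-component is the difference of the two sides of (1)
([jacobiator211_fst]), and the pairing of its E2-component with be is the
left-hand side of (3) ([jacobiator211_snd]), since Courant invariance turns
<al . T(a1, a2), be> into the terms of the curvature of nablal. On E1 alone,
J(a1, a2, a3) has as E1-component minus the cyclic sum in (4)
([jacobiator111_fst]), where the terms nablal_{D2 f} drop out, and an E2-component
determined by J(a1, a2, be). Exchanging E1 and E2 gives (2), (3) again and (5).

All of this rests on two facts about the metric of a vector bundle: a section is
determined by its inner products with all sections ([inner_nondeg]), and every
C^infty(M)-linear functional on sections is an inner product with a smooth
section ([inner_dual_sect]), so that D, Omega and Mho have their defining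
properties. Both are proved by multiplying a local frame by a bump function: the
resulting global sections span the fibres near a given point, and the
representing section is obtained there with the inverse of their Gram matrix. The
bump functions are built from exp(-1/t). *)

(** * The function exp(-1/t) *)

Section FlatFunction.
Variable R : realType.
Implicit Types (t : R) (m : nat).

(** The factor t^-m makes the family stable under differentiation up to linear
combinations ([flat_is_derive]), so smoothness of compositions with [flat] follows
by induction without computing higher derivatives. *)
Definition flat m t : R := if 0 < t then t^-1 ^+ m * expR (- t^-1) else 0.

Lemma flat_le0 m t : t <= 0 -> flat m t = 0.
Proof. by rewrite /flat ltNge => ->. Qed.

Lemma flat0_eq0 t : (flat 0 t == 0) = (t <= 0).
Proof.
rewrite /flat expr0 mul1r; case: ltP => t0; last by rewrite eqxx.
by rewrite gt_eqF// expR_gt0.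
Qed.

Lemma flatS m t : flat m.+1 t = t^-1 * flat m t.
Proof. by rewrite /flat; case: ifP => _; rewrite ?mulr0// exprS mulrA. Qed.

(** From x^(m+1)/(m+1)! <= exp x at x = 1/t. It gives the limit 0 at 0 of every
[flat m], hence also, by [flatS], of the difference quotients at 0. *)
Lemma flat_bound m t : `|flat m t| <= m.+1`!%:R * `|t|.
Proof.
have [t0|t0] := ltP 0 t; last first.
  by rewrite flat_le0// normr0 mulr_ge0// ler0n.
rewrite /flat t0 !gtr0_norm//; last first.
  by rewrite mulr_gt0 ?exprn_gt0 ?expR_gt0 ?invr_gt0.
have s0 : 0 < t^-1 by rewrite invr_gt0.
have := expR_ge1Dxn m (ltW s0); rewrite expRN => le1.
have F0 : 0 < (m.+1)`!%:R :> R by rewrite ltr0n fact_gt0.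
rewrite ler_pdivrMr ?expR_gt0//.
have {}le1 : t^-1 ^+ m.+1 / m.+1`!%:R <= expR t^-1.
  by apply: le_trans le1; rewrite lerDr.
apply: (@le_trans _ _ (m.+1`!%:R * t * (t^-1 ^+ m.+1 / m.+1`!%:R)));
  last first.
  by rewrite ler_wpM2l// mulr_ge0// ltW.
rewrite exprS le_eqVlt; apply/orP; left; apply/eqP.
by field; rewrite !gt_eqF.
Qed.

Lemma flat_cvg0 m : flat m t @[t --> 0^'] --> (0 : R).
Proof.
apply: norm_cvg0.
have lin : (m.+1`!%:R : R) * `|t| @[t --> (0:R)^'] --> (0 : R).
  rewrite -[X in _ --> X](mulr0 (m.+1`!%:R : R)); apply: cvgMr.
  rewrite -[X in _ --> X](@normr0 _ R); apply: cvg_norm.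
  exact: cvg_within.
apply: (squeeze_cvgr _ (cvg_cst 0) lin).
by near=> t; rewrite normr_ge0 flat_bound.
Unshelve. all: by end_near. Qed.

Lemma flat_is_derive m t :
  is_derive t 1 (flat m) (flat m.+2 t - m%:R * flat m.+1 t).
Proof.
have [t0|t0|->] := ltgtP t 0.
- rewrite !flat_le0 ?(ltW t0)// mulr0 subr0.
  apply: (@near_eq_is_derive _ _ _ (cst 0)).
    near=> s; rewrite flat_le0// ltW//; near: s; exact: lt_nbhsl.
- apply: (@near_eq_is_derive R R R
    ((fun s : R => s^-1) ^+ m * (fun s : R => expR (- s^-1)))).
    near=> s; rewrite /flat ifT ?fctE//; near: s; exact: lt_nbhsr.
  have dV : is_derive t 1 (fun s : R => s^-1) (- t ^- 2).
    apply: DeriveDef; first by apply: derivableV => //; rewrite gt_eqF.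
    by rewrite deriveV ?gt_eqF// derive_id /= [_%:A]mulr1.
  have dE : is_derive t 1 (fun s : R => expR (- s^-1)) (t ^- 2 * expR (- t^-1)).
    have dN : is_derive t 1 (fun s : R => - s^-1) (t ^- 2).
      by apply: is_derive_eq; rewrite opprK.
    apply: is_derive_eq (is_derive1_comp (f := expR) _ dN) _.
    exact: mulrC.
  apply: is_derive_eq (is_deriveM (is_deriveX m dV) dE) _.
  rewrite /flat t0 /GRing.scale /= !fctE.
  case: m => [|m] /=; rewrite ?expr0 ?exprS.
    by field; rewrite gt_eqF.
  by field; rewrite gt_eqF.
- have cv0 : h^-1 *: (flat m (h *: (1:R) + 0) - flat m 0)
      @[h --> (0:R)^'] --> (0:R).
    under eq_fun => h do
      rewrite addr0 [_ *: (1:R)]mulr1 (flat_le0 m (lexx 0)) subr0 -[_ *: _]flatS.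
    exact: flat_cvg0.
  rewrite !flat_le0// mulr0 subrr.
  apply: DeriveDef; first by apply/cvg_ex; exists 0.
  by apply: cvg_lim cv0.
Unshelve. all: try by end_near. Qed.
End FlatFunction.

(** * Compositions and inverses of smooth functions *)

Section CkComposition.
Variables (R : realType) (n : nat) (U : set 'rV[R]_n).
Implicit Types (f : R -> R) (h : 'rV[R]_n -> R).

Lemma is_derive_line h x v b :
  is_derive x v h b <-> is_derive (0 : R) 1 (fun t : R => h (t *: v + x)) b.
Proof.
have E : 'D_1 (fun t : R => h (t *: v + x)) 0 = 'D_v h x.
  rewrite /derive; set g1 := fun t => t^-1 *: _; set g2 := fun t => t^-1 *: _.
  suff -> : g1 = g2 by []; apply/funext => t; rewrite /g1 /g2 /=.
  by rewrite addr0 scale0r add0r [_%:A]mulr1.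
split=> -[hd hb]; split.
- exact: (derivable1P h x v).1.
- by rewrite E.
- exact: (derivable1P h x v).2.
- by rewrite -E.
Qed.

(** For an outer function of one real variable, restricting to the line x + t v
reduces the chain rule to the one-dimensional one, without total derivatives. *)
Lemma is_derive_comp f h x v a b :
  is_derive (h x) 1 f a -> is_derive x v h b ->
  is_derive x v (fun y => f (h y)) (a * b).
Proof.
move=> fa /is_derive_line hb; apply/is_derive_line.
apply: (@is_derive1_comp R f (fun t : R => h (t *: v + x)) 0) => //.
by rewrite scale0r add0r.
Qed.

Hypothesis oU : open U.

Lemma flat_continuous m : continuous (@flat R m).
Proof.
move=> t; apply/differentiable_continuous/derivable1_diffP.
by have [] := flat_is_derive m t.
Qed.

(** The statement quantifies over [m] because the derivative of [flat m] involves
[flat m.+1] and [flat m.+2]. *)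
Lemma Ck_flat k m h : Ck k U h -> Ck k U (fun x => flat m (h x)).
Proof.
elim: k m h => [|k IH] m h /[dup] hk [ch dh].
  split=> // x Ux.
  by apply: continuous_comp; [exact: ch|exact: flat_continuous].
split=> [x Ux|].
  by apply: continuous_comp; [exact: ch|exact: flat_continuous].
move=> v; have [h1 h2] := dh v.
have D x : U x -> is_derive x v (fun x => flat m (h x))
    ((flat m.+2 (h x) - m%:R * flat m.+1 (h x)) * 'D_v h x).
  move=> Ux; apply: is_derive_comp (flat_is_derive _ _) _.
  exact: derivableP (h1 _ Ux).
split=> [x Ux|]; first by have [] := D x Ux.
apply: (Ck_ext oU (f := fun x =>
    (flat m.+2 (h x) - m%:R * flat m.+1 (h x)) * 'D_v h x)).
  by move=> x Ux; rewrite [RHS](@derive_val _ _ _ _ _ _ _ (D x Ux)).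
apply: CkM => //; under eq_fun do rewrite -mulNr.
by apply: CkD => //; [|apply: CkM => //; first exact: Ck_cst];
  apply: IH; exact: CkW.
Qed.

Lemma Ck_inv k h : (forall x, U x -> h x != 0) -> Ck k U h ->
  Ck k U (fun x => (h x)^-1).
Proof.
move=> h0; elim: k => [|k IH] /[dup] hk [ch dh].
  by split=> // x Ux; apply: continuousV; [exact: h0|exact: ch].
split; first by move=> x Ux; apply: continuousV; [exact: h0|exact: ch].
move=> v; have [h1 h2] := dh v; split=> [x Ux|].
  by apply: derivableV; [exact: h0|exact: h1].
have Vk := IH (CkW hk).
apply: (Ck_ext oU (f := fun x => -1 * ((h x)^-1 * (h x)^-1) * 'D_v h x)).
  move=> x Ux; rewrite [RHS]deriveV; [|exact: h0|exact: h1].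
  by rewrite mulN1r expr2 invfM.
apply: CkM => //; apply: CkM => //; first exact: Ck_cst.
exact: CkM.
Qed.

End CkComposition.

(** * Smooth functions and bump functions on a manifold *)

Section SmoothFunctions.
Variables (R : realType) (n : nat) (M : manifold R n).
Implicit Types (U : set M) (f : M -> R).

Lemma smooth_on_sum U (I : Type) (r : seq I) (F : I -> M -> R) : open U ->
  (forall i, smooth_on U (F i)) -> smooth_on U (fun x => \sum_(i <- r) F i x).
Proof.
move=> oU FU; elim: r => [|i r IH].
  by under eq_fun do rewrite big_nil; exact: smooth_on_cst.
by under eq_fun do rewrite big_cons; exact: smooth_onD.
Qed.

Lemma smooth_on_prod U (I : Type) (r : seq I) (F : I -> M -> R) : open U ->
  (forall i, smooth_on U (F i)) -> smooth_on U (fun x => \prod_(i <- r) F i x).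
Proof.
move=> oU FU; elim: r => [|i r IH].
  by under eq_fun do rewrite big_nil; exact: smooth_on_cst.
by under eq_fun do rewrite big_cons; exact: smooth_onM.
Qed.

Lemma smooth_on_flat U m f : open U -> smooth_on U f ->
  smooth_on U (fun x => flat m (f x)).
Proof.
move=> oU fU c cM k; apply: Ck_flat; last exact: fU.
exact: open_chart_preimage.
Qed.

Lemma smooth_on_inv U f : open U -> (forall x, U x -> f x != 0) ->
  smooth_on U f -> smooth_on U (fun x => (f x)^-1).
Proof.
move=> oU f0 fU c cM k; apply: Ck_inv; last exact: fU.
  exact: open_chart_preimage.
by move=> y [_ /f0].
Qed.

Lemma smooth_on_det U p (G : M -> 'M[R]_p) : open U ->
  (forall i j, smooth_on U (fun x => G x i j)) ->
  smooth_on U (fun x => \det (G x)).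
Proof.
move=> oU GU; apply: smooth_on_sum => // s; apply: smooth_onM => //.
  exact: smooth_on_cst.
exact: smooth_on_prod.
Qed.

(** Cramer's rule: the entries of the inverse are cofactors over the determinant. *)
Lemma smooth_on_invmx U p (G : M -> 'M[R]_p) : open U ->
  (forall x, U x -> G x \in unitmx) ->
  (forall i j, smooth_on U (fun x => G x i j)) ->
  forall i j, smooth_on U (fun x => invmx (G x) i j).
Proof.
move=> oU Gu GU i j.
apply: (smooth_on_ext oU (f := fun x => (\det (G x))^-1 * cofactor (G x) j i)).
  by move=> x Ux; rewrite /invmx Gu// !mxE.
apply: smooth_onM => //.
  apply: smooth_on_inv (smooth_on_det oU GU) => // x /Gu.
  by rewrite unitmxE unitfE.
apply: smooth_onM => //; first exact: smooth_on_cst.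
apply: smooth_on_det => // k l; under eq_fun do rewrite !mxE.
exact: GU.
Qed.

(** This is the compatibility of the atlas, read in the other charts. *)
Lemma smooth_on_coord (c : chart R n M) i : atlas c ->
  smooth_on (chart_dom c) (fun x => c x ord0 i).
Proof. by move=> cM d dM; exact: atlas_compatible. Qed.

Lemma smooth_on_continuous U f x : open U -> smooth_on U f -> U x ->
  {for x, continuous f}.
Proof.
move=> oU fU Ux; have [c cM cx] := atlas_cover x.
have [fc _] := fU c cM 0%N.
have fcx : {for c x, continuous (f \o chart_inv c)}.
  by apply: fc; split; [exact: chart_mapP|rewrite /= chart_mapK].
have := continuous_comp (chart_map_continuous cx) fcx.
rewrite /prop_for /continuous_at /= chart_mapK//; apply: cvg_trans.
apply: near_eq_cvg.
apply: filterS (open_nbhs_nbhs (conj (open_chart_dom c) cx)).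
by move=> y cy /=; rewrite chart_mapK.
Qed.

Lemma smooth_fun_on (f : smooth_fun M) U : smooth_on U f.
Proof. by apply: smooth_onS (subsetT _) _; apply/smooth_predP/smooth_valP. Qed.

Lemma open_smooth_neq0 (f : smooth_fun M) : open [set x | f x != 0].
Proof.
have cf : continuous f.
  by move=> x; apply: smooth_on_continuous openT (smooth_fun_on _ _) _.
apply: (open_comp (f := f) (D := [set y | y != 0])) => [x _|]; first exact: cf.
exact: open_neq.
Qed.

(** In a chart c around x0, the function [flat 0] of s^2 - |c x - c x0|^2 vanishes
outside a ball whose closure lies in the image of U. The cube K containing this
ball is compact, so its image C in M is compact, and closed since M is Hausdorff;
this is what makes the extension by zero smooth. *)
Lemma exists_bump U x0 : open U -> U x0 ->
  exists (chi : smooth_fun M) (C : set M),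
    [/\ closed C, C `<=` U, forall x, ~ C x -> chi x = 0 & chi x0 != 0].
Proof.
move=> oU Ux0; have [c cM cx0] := atlas_cover x0.
have : nbhs (c x0) (chart_cod c `&` chart_inv c @^-1` U).
  apply: open_nbhs_nbhs; split; first exact: open_chart_preimage.
  by split; [exact: chart_mapP|rewrite /= chart_mapK].
move=> /nbhs_ballP[r /= r0 rW].
pose s := r / 2; have s0 : 0 < s by rewrite divr_gt0.
pose K : set 'rV[R]_n := [set y | forall i : 'I_n,
  `[c x0 ord0 i - s, c x0 ord0 i + s]%classic (y ord0 i)].
have KW : K `<=` chart_cod c `&` chart_inv c @^-1` U.
  move=> y Ky; apply: rW; split=> // i j; rewrite ord1 /ball /=.
  have := Ky j; rewrite /= in_itv /= => /andP[y1 y2].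
  by rewrite distrC ltr_distl; apply/andP; split; rewrite /s in y1 y2; lra.
have cK : compact K.
  apply: (@rV_compact R n (fun i => `[_, _]%classic)) => i.
  exact: segment_compact.
pose C := chart_inv c @` K.
have cC : closed C.
  apply: compact_closed (@mfd_hausdorff _ _ M) _.
  apply: continuous_compact cK; apply: continuous_in_subspaceT => y.
  by rewrite inE => /KW[cy _]; exact: chart_inv_continuous.
pose d x := s ^+ 2 - \sum_(i < n) (c x ord0 i - c x0 ord0 i) ^+ 2.
pose chi x := if `[< chart_dom c x >] then flat 0 (d x) else 0.
have supp x : ~ C x -> chi x = 0.
  rewrite /chi; case: asboolP => // cx Cx; apply/eqP; rewrite flat0_eq0.
  rewrite leNgt; apply/negP => dx; apply: Cx.
  exists (c x); last exact: chart_mapK.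
  move=> i; rewrite /= in_itv/=.
  have ui : (c x ord0 i - c x0 ord0 i) ^+ 2 <= s ^+ 2.
    move: dx; rewrite /d subr_gt0 => /ltW; apply: le_trans.
    by rewrite (bigD1 i)//= lerDl sumr_ge0// => j _; exact: sqr_ge0.
  rewrite -ler_distl -ler_sqr ?nnegrE ?normr_ge0 ?(ltW s0)//.
  by rewrite real_normK ?num_real.
have chiM : smooth_on setT chi.
  apply: smooth_on_local => x _.
  have [Cx|Cx] := pselect (C x); last first.
    exists (~` C) => //.
    apply: smooth_on_ext (smooth_on_cst 0 _) => [||]; try exact: closed_openC.
    by move=> y /supp.
  have cx : chart_dom c x.
    by case: Cx => y /KW[cy _] <-; exact: chart_invP.
  exists (chart_dom c) => //.
  have oc := open_chart_dom c.
  apply: (smooth_on_ext oc (f := fun x => flat 0 (d x))).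
    by move=> y cy; rewrite /chi; case: asboolP.
  apply: smooth_on_flat => //; apply: smooth_onD => //.
    exact: smooth_on_cst.
  apply: smooth_onN => //; apply: smooth_on_sum => // i.
  have sc : smooth_on (chart_dom c) (fun x => c x ord0 i - c x0 ord0 i).
    by apply: smooth_onD => //; [exact: smooth_on_coord|exact: smooth_on_cst].
  by under eq_fun do rewrite expr2; apply: smooth_onM.
exists (smooth_of chiM), C; split => //.
  by move=> _ [y /KW[_ Uy] <-].
rewrite /= /chi; case: asboolP => // _; rewrite flat0_eq0 -ltNge /d.
by rewrite big1 ?subr0 ?exprn_gt0// => i _; rewrite subrr expr0n.
Qed.

Lemma smooth_extend (chi : smooth_fun M) C U f :
  closed C -> C `<=` U -> (forall x, ~ C x -> chi x = 0) -> open U ->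
  smooth_on U f -> smooth_on setT (fun x => chi x * f x).
Proof.
move=> cC CU supp oU fU; apply: smooth_on_local => x _.
have [Cx|Cx] := pselect (C x).
  exists U; first exact: CU.
  by apply: smooth_onM => //; exact: smooth_fun_on.
exists (~` C) => //.
apply: smooth_on_ext (smooth_on_cst 0 _) => [||]; try exact: closed_openC.
by move=> y /supp ->; rewrite mul0r.
Qed.

End SmoothFunctions.

(** * Local frames and the metric duality of sections *)

Section LocalFrames.
Variables (R : realType) (n : nat) (M : manifold R n).

Lemma smooth_fun_eqP (f g : smooth_fun M) : (forall x, f x = g x) -> f = g.
Proof. by move=> fg; apply/val_inj/funext. Qed.

Variable E : bundle M.

Lemma sect_sumE (I : Type) (r : seq I) (F : I -> sect E) x :
  (\sum_(i <- r) F i) x = \sum_(i <- r) F i x.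
Proof. by elim/big_rec2: _ => // i u v _ <-. Qed.

Lemma triv_map_inj (t : local_triv E) x : triv_dom t x ->
  injective (triv_map t x).
Proof. by move=> /triv_bij/bij_inj. Qed.

(** The sections [e i] are the coordinate frame of the trivialization [t] times the
bump function [chi], extended by zero. The coefficients of a section s in the
coordinate frame, times [chi], are global smooth functions as well, whence the
factor [chi * chi] in the decomposition. Since the decomposition holds globally, a
C^infty(M)-linear functional can be applied to it. *)
Lemma local_frame (t : local_triv E) x0 : trivs t -> triv_dom t x0 ->
  exists (chi : smooth_fun M) (e : 'I_(triv_rank t) -> sect E)
         (coef : sect E -> 'I_(triv_rank t) -> smooth_fun M),
    [/\ chi x0 != 0,
        forall x, chi x != 0 -> triv_dom t x,
        forall x i, triv_dom t x ->
          triv_map t x (e i x) = chi x *: delta_mx ord0 i &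
        forall s, (chi * chi) *: s = \sum_i coef s i *: e i].
Proof.
move=> tE tx0; have ot := open_triv_dom t.
have [chi [C [cC Ct supp chi0]]] := exists_bump ot tx0.
have chit x : chi x != 0 -> triv_dom t x.
  by move=> cx; apply: Ct; apply: contrapT => /supp; exact/eqP.
pose e i x : E x :=
  xget 0 [set v | triv_dom t x /\ triv_map t x v = chi x *: delta_mx ord0 i].
have eE x i : triv_dom t x -> triv_map t x (e i x) = chi x *: delta_mx ord0 i.
  move=> tx; have [h _ hK] := triv_bij tx.
  rewrite /e; case: xgetP => [v _ [_ //]|/(_ (h (chi x *: delta_mx ord0 i)))].
  by case; split=> //; rewrite hK.
have e0 x i : chi x = 0 -> e i x = 0.
  have [tx cx|tx _] := pselect (triv_dom t x).
    by apply: (triv_map_inj tx); rewrite eE// cx scale0r linear0.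
  by rewrite /e; case: xgetP => // v _ [].
have eS i : smooth_section (e i).
  move=> t' t'E j; have ot' := open_triv_dom t'.
  apply: smooth_on_local => x t'x.
  have [Cx|Cx] := pselect (C x).
    have [g [gS gE]] := trivs_compatible tE t'E.
    exists (triv_dom t `&` triv_dom t'); first by split=> //; exact: Ct.
    have ott' := openI ot ot'.
    apply: (smooth_on_ext ott' (f := fun x => chi x * g x i j)).
      by move=> y [ty t'y]; rewrite gE// eE// -scalemxAl -rowE !mxE.
    by apply: smooth_onM => //; exact: smooth_fun_on.
  exists (~` C `&` triv_dom t') => //.
  have oC : open (~` C `&` triv_dom t').
    by apply: openI => //; exact: closed_openC.
  apply: smooth_on_ext oC _ (smooth_on_cst 0 oC).
  by move=> y [/supp cy _]; rewrite e0// linear0 mxE.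
have coefS (s : sect E) i :
    smooth_on setT (fun x => chi x * triv_map t x (s x) ord0 i).
  by apply: smooth_extend cC Ct supp ot _; exact: sect_valP.
exists chi, (fun i => Sect (eS i)), (fun s i => smooth_of (coefS s i)).
split=> // s; apply: sect_eqP => x; rewrite sect_sumE.
have [tx|tx] := pselect (triv_dom t x); last first.
  have cx : chi x = 0 by apply: contra_notP tx => /eqP/chit.
  rewrite big1 => [|i _].
    by rewrite -[LHS]/((chi x * chi x) *: s x) cx mul0r scale0r.
  by rewrite -[LHS]/((chi x * _) *: e i x) cx mul0r scale0r.
apply: (triv_map_inj tx).
rewrite -[in LHS]/((chi x * chi x) *: s x) linearZ linear_sum /=.
rewrite [X in _ *: X]row_sum_delta scaler_sumr; apply: eq_bigr => i _.
rewrite [RHS]linearZ /= eE// !scalerA; congr (_ *: _); exact: mulrAC.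
Qed.

Lemma sect_through x (v : E x) : exists s : sect E, s x = v.
Proof.
have [t tE tx] := trivs_cover E x.
have [chi [e [_ [c0 _ eE _]]]] := local_frame tE tx.
exists (\sum_i smooth_cst M ((chi x)^-1 * triv_map t x v ord0 i) *: e i).
apply: (triv_map_inj tx); rewrite sect_sumE linear_sum.
rewrite [RHS]row_sum_delta; apply: eq_bigr => i _.
rewrite -[(_ *: _ : sect E) x]/(((chi x)^-1 * triv_map t x v ord0 i) *: e i x).
by rewrite linearZ /= eE// scalerA mulrAC mulVf// mul1r.
Qed.

Variable g : metric E.

Lemma metric_suml x (I : Type) (r : seq I) (k : I -> R) (u : I -> E x) v :
  metric_at g (\sum_(i <- r) k i *: u i) v =
  \sum_(i <- r) k i * metric_at g (u i) v.
Proof.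
elim: r => [|i r IH]; last by rewrite !big_cons metric_linear IH.
by rewrite !big_nil Defs.metric_sym metric0r.
Qed.

Lemma innerE (s t : sect E) x : inner g s t x = metric_at g (s x) (t x).
Proof. by []. Qed.

Lemma metric_at_inj x (u v : E x) :
  (forall c : sect E, metric_at g (c x) u = metric_at g (c x) v) -> u = v.
Proof.
move=> uv; apply/eqP; rewrite -subr_eq0; apply/eqP.
apply: (metric_nondeg (m := g)) => z; have [c <-] := sect_through z.
rewrite addrC -scaleN1r metric_linear mulN1r !(Defs.metric_sym g _ (c x)).
by rewrite uv addNr.
Qed.

Lemma inner_nondeg (s t : sect E) :
  (forall c, inner g c s = inner g c t) -> s = t.
Proof.
move=> st; apply: sect_eqP => x; apply: metric_at_inj => c.
by rewrite -!innerE st.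
Qed.

(** Where [chi] does not vanish, the vectors [e i x] form a basis, so their Gram
matrix G x is invertible by nondegeneracy, and v = sum_i (G^-1 W)_i e_i with
W_i = w (e_i) satisfies <e_i, v> = w (e_i). The identity for all sections c follows
by applying w to the decomposition of chi^2 c. The coordinates of v in the
trivialization are recorded because they witness its smoothness. *)
Lemma dual_sect_local (w : sect E -> smooth_fun M) (t : local_triv E) x0 :
  (forall f s s', w (f *: s + s') = f * w s + w s') ->
  trivs t -> triv_dom t x0 ->
  exists (U : set M) (a : 'I_(triv_rank t) -> M -> R) (v : forall x, E x),
    [/\ open U, U x0, forall i, smooth_on U (a i),
        forall x, U x -> forall i, triv_map t x (v x) ord0 i = a i x &
        forall x, U x -> forall c : sect E, metric_at g (c x) (v x) = w c x].
Proof.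
move=> wL tE tx0.
have w0 : w 0 = 0.
  have := wL 1 0 0; rewrite scale1r addr0 mul1r => /(congr1 (+%R^~ (- w 0))).
  by rewrite subrr addrK => <-.
have wsum (I : Type) (r : seq I) (F : I -> smooth_fun M) (G : I -> sect E) :
    w (\sum_(i <- r) F i *: G i) = \sum_(i <- r) F i * w (G i).
  by elim: r => [|i r IH]; rewrite ?big_nil// !big_cons wL IH.
have [chi [e [coef [chi0 chit eE decomp]]]] := local_frame tE tx0.
pose U := [set x | chi x != 0].
have oU : open U := open_smooth_neq0 chi.
have span x (c : sect E) : U x ->
    c x = \sum_i ((chi x * chi x)^-1 * coef c i x) *: e i x.
  move=> Ux; have := congr1 (fun s : sect E => s x) (decomp c).
  rewrite sect_sumE => cE.
  have {}cE : (chi x * chi x) *: c x = \sum_i coef c i x *: e i x := cE.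
  have cc0 : chi x * chi x != 0 by rewrite mulf_neq0.
  rewrite -[LHS](scalerK cc0) cE scaler_sumr; apply: eq_bigr => i _.
  by rewrite scalerA.
pose G x := \matrix_(i, j) metric_at g (e i x) (e j x).
have GS i j : smooth_on U (fun x => G x i j).
  apply: (smooth_on_ext oU (f := inner g (e i) (e j))) => [x _|].
    by rewrite /G mxE.
  exact: smooth_fun_on.
have trivE x (u : 'I_(triv_rank t) -> R) i : U x ->
    triv_map t x (\sum_j u j *: e j x) ord0 i = chi x * u i.
  move=> Ux; have tx := chit x Ux.
  rewrite linear_sum summxE (bigD1 i)//= big1 => [|j /negPf ji].
    by rewrite linearZ /= eE// !mxE !eqxx/= mulr1 addr0 mulrC.
  by rewrite linearZ /= eE// !mxE eq_sym ji andbF !mulr0.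
have Gu x : U x -> G x \in unitmx.
  move=> Ux; rewrite -row_free_unit; apply: inj_row_free => u uG.
  have z0 : \sum_i u ord0 i *: e i x = 0.
    apply: (metric_nondeg (m := g)) => y; have [c <-] := sect_through y.
    rewrite (span x c Ux) Defs.metric_sym metric_suml big1// => j _.
    rewrite Defs.metric_sym metric_suml.
    have := congr1 (fun A : 'rV_(triv_rank t) => A ord0 j) uG.
    rewrite !mxE => uGj.
    rewrite [X in _ * X](_ : _ = 0) ?mulr0// -[RHS]uGj.
    by apply: eq_bigr => i _; rewrite /G mxE.
  apply/rowP => i; rewrite mxE; have := trivE x (u ord0) i Ux.
  by rewrite z0 linear0 mxE => /esym/eqP; rewrite mulf_eq0 (negPf Ux)/= => /eqP.
pose a i x := \sum_j invmx (G x) i j * w (e j) x.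
exists U, (fun i x => chi x * a i x), (fun x => \sum_i a i x *: e i x).
split=> //.
- move=> i; apply: smooth_onM => //; first exact: smooth_fun_on.
  apply: smooth_on_sum => // j; apply: smooth_onM => //.
    exact: smooth_on_invmx.
  exact: smooth_fun_on.
- by move=> x Ux i; rewrite trivE.
move=> x Ux c.
have ew i : metric_at g (e i x) (\sum_j a j x *: e j x) = w (e i) x.
  pose W := \col_j (w (e j) x).
  have aE j : a j x = (invmx (G x) *m W) j ord0.
    by rewrite mxE; apply: eq_bigr => k _; rewrite /W mxE.
  have := congr1 (fun A : 'cV_(triv_rank t) => A i ord0) (mulKVmx (Gu x Ux) W).
  rewrite [RHS]mxE => <-; rewrite Defs.metric_sym metric_suml mxE.
  apply: eq_bigr => j _; rewrite aE mulrC Defs.metric_sym; congr (_ * _).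
  by rewrite /G mxE.
have cc0 : chi x * chi x != 0 by rewrite mulf_neq0.
apply: (mulfI cc0).
have -> : chi x * chi x * w c x = ((chi * chi : smooth_fun M) * w c) x by [].
have wc : (chi * chi) * w c = \sum_i coef c i * w (e i).
  have := wL (chi * chi) c 0; rewrite addr0 w0 addr0 => <-.
  by rewrite decomp wsum.
have sumE (F : 'I_(triv_rank t) -> smooth_fun M) :
    (\sum_i F i) x = \sum_i F i x.
  by elim/big_rec2: _ => // i u y _ <-.
rewrite wc sumE (span x c Ux) metric_suml mulr_sumr; apply: eq_bigr => i _.
by rewrite ew mulrA mulVKf.
Qed.

(** The local solutions of [dual_sect_local] agree wherever they are defined, by
[metric_at_inj], so they glue to a smooth section. *)
Lemma dual_sect_exists (w : sect E -> smooth_fun M) :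
  (forall f s s', w (f *: s + s') = f * w s + w s') ->
  exists s, forall c, inner g c s = w c.
Proof.
move=> wL.
pose s x : E x :=
  xget 0 [set v | forall c : sect E, metric_at g (c x) v = w c x].
have sE x c : metric_at g ((c : sect E) x) (s x) = w c x.
  have [t tE tx] := trivs_cover E x.
  have [U [_ [v [_ Ux _ _ vE]]]] := dual_sect_local wL tE tx.
  rewrite /s; case: xgetP => [u _ -> //|/(_ (v x))]; case; exact: vE.
have sS : smooth_section s.
  move=> t tE i; apply: smooth_on_local => x tx.
  have [U [a [v [oU Ux aS aE vE]]]] := dual_sect_local wL tE tx.
  exists U => //; apply: smooth_on_ext oU _ (aS i) => y Uy.
  rewrite -aE//; congr (triv_map t y _ ord0 i).
  by apply: metric_at_inj => c; rewrite sE vE.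
by exists (Sect sS) => c; apply: smooth_fun_eqP => x; exact: sE.
Qed.

Lemma inner_dual_sect (w : sect E -> smooth_fun M) c :
  (forall f s s', w (f *: s + s') = f * w s + w s') ->
  inner g c (dual_sect g w) = w c.
Proof.
move=> /dual_sect_exists[s sE]; rewrite /dual_sect.
by case: xgetP => [u _ -> //|/(_ s)]; case.
Qed.

End LocalFrames.

(** * Calculus of sections in a Courant algebroid *)

Section SectionCalculus.
Variables (R : realType) (n : nat) (M : manifold R n).
Implicit Types (f h : smooth_fun M).

Lemma smooth_cst1 : smooth_cst M 1 = 1.
Proof. exact: smooth_fun_eqP. Qed.

Lemma smooth_halfD f : smooth_half M * f + smooth_half M * f = f.
Proof.
apply: smooth_fun_eqP => x; rewrite -[LHS]/(2^-1 * f x + 2^-1 * f x).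
by rewrite -mulrDl -[2^-1]div1r -splitr mul1r.
Qed.

Lemma smooth_double_inj f h : f + f = h + h -> f = h.
Proof.
by move=> fh; rewrite -(smooth_halfD f) -(smooth_halfD h) -!mulrDr fh.
Qed.

Section Inner.
Variables (E : bundle M) (g : metric E).
Implicit Types (s t u : sect E).

Lemma inner_linear f s t u :
  inner g (f *: s + t) u = f * inner g s u + inner g t u.
Proof. by apply: smooth_fun_eqP => x; exact: metric_linear. Qed.

Lemma innerC s t : inner g s t = inner g t s.
Proof. by apply: smooth_fun_eqP => x; exact: Defs.metric_sym. Qed.

Lemma innerDl s t u : inner g (s + t) u = inner g s u + inner g t u.
Proof. by have := inner_linear 1 s t u; rewrite scale1r mul1r. Qed.

Lemma inner0l u : inner g 0 u = 0.
Proof. by apply: (addIr (inner g 0 u)); rewrite -innerDl !add0r. Qed.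

Lemma innerZl f s u : inner g (f *: s) u = f * inner g s u.
Proof. by rewrite -[f *: s]addr0 inner_linear inner0l addr0. Qed.

Lemma innerNl s u : inner g (- s) u = - inner g s u.
Proof. by rewrite -scaleN1r innerZl mulN1r. Qed.

Lemma innerDr u s t : inner g u (s + t) = inner g u s + inner g u t.
Proof. by rewrite innerC innerDl !(innerC u). Qed.

Lemma inner0r u : inner g u 0 = 0.
Proof. by rewrite innerC inner0l. Qed.

Lemma innerZr f u s : inner g u (f *: s) = f * inner g u s.
Proof. by rewrite innerC innerZl innerC. Qed.

Lemma innerNr u s : inner g u (- s) = - inner g u s.
Proof. by rewrite innerC innerNl innerC. Qed.

End Inner.

Section AnchorDer.
Variables (E : bundle M) (rho : anchor E).
Implicit Types s t : sect E.

Lemma anchor_der_linear h f s t :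
  anchor_der rho (f *: s + t) h = f * anchor_der rho s h + anchor_der rho t h.
Proof.
apply: smooth_fun_eqP => x.
rewrite -[LHS]/(anchor_at rho x (f x *: s x + t x) h).
by rewrite linearP.
Qed.

Lemma anchor_derDr s f h :
  anchor_der rho s (f + h) = anchor_der rho s f + anchor_der rho s h.
Proof.
apply: smooth_fun_eqP => x.
by have /asboolP[D _] := tangent_valP (anchor_at rho x (s x)); exact: D.
Qed.

Lemma anchor_der_half s f :
  anchor_der rho s (smooth_half M * f) = smooth_half M * anchor_der rho s f.
Proof.
apply: smooth_fun_eqP => x.
by have /asboolP[_ [Z _]] := tangent_valP (anchor_at rho x (s x)); exact: Z.
Qed.

Lemma anchor_der0r s : anchor_der rho s 0 = 0.
Proof.
by apply: (addIr (anchor_der rho s 0)); rewrite -anchor_derDr !add0r.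
Qed.

Lemma anchor_derNr s f : anchor_der rho s (- f) = - anchor_der rho s f.
Proof. by apply/eqP; rewrite -addr_eq0 -anchor_derDr addNr anchor_der0r. Qed.

End AnchorDer.

Section RBilinear.
Variables (E F G : bundle M) (b : sect E -> sect F -> sect G).
Hypothesis b_lin : rbilinear b.

Lemma rbilinearDl s s' t : b (s + s') t = b s t + b s' t.
Proof.
by have [L _] := b_lin; have := L 1 s s' t; rewrite smooth_cst1 !scale1r.
Qed.

Lemma rbilinearDr s t t' : b s (t + t') = b s t + b s t'.
Proof.
by have [_ L] := b_lin; have := L 1 s t t'; rewrite smooth_cst1 !scale1r.
Qed.

Lemma rbilinear0l t : b 0 t = 0.
Proof. by apply: (addIr (b 0 t)); rewrite -rbilinearDl !add0r. Qed.

Lemma rbilinear0r s : b s 0 = 0.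
Proof. by apply: (addIr (b s 0)); rewrite -rbilinearDr !add0r. Qed.

Lemma rbilinearNl s t : b (- s) t = - b s t.
Proof. by apply/eqP; rewrite -addr_eq0 -rbilinearDl addNr rbilinear0l. Qed.

Lemma rbilinearNr s t : b s (- t) = - b s t.
Proof. by apply/eqP; rewrite -addr_eq0 -rbilinearDr addNr rbilinear0r. Qed.

End RBilinear.

Section CourantData.
Variable E : courant_data M.

Lemma inner_cD c f : inner (cmetric E) c (cD E f) = anchor_der (canchor E) c f.
Proof. by apply: inner_dual_sect => k s t; exact: anchor_der_linear. Qed.

Lemma cDD f h : cD E (f + h) = cD E f + cD E h.
Proof.
apply: (inner_nondeg (g := cmetric E)) => c.
by rewrite innerDr !inner_cD anchor_derDr.
Qed.

Lemma cD_half f : cD E (smooth_half M * f) = smooth_half M *: cD E f.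
Proof.
apply: (inner_nondeg (g := cmetric E)) => c.
by rewrite innerZr !inner_cD anchor_der_half.
Qed.

Lemma cD0 : cD E 0 = 0.
Proof.
apply: (inner_nondeg (g := cmetric E)) => c.
by rewrite inner_cD anchor_der0r inner0r.
Qed.

Lemma cDN f : cD E (- f) = - cD E f.
Proof. by apply/eqP; rewrite -addr_eq0 -cDD addNr cD0. Qed.

End CourantData.

Section Courant.
Variable E : courant_algebroid M.
Local Notation ip := (inner (cmetric E)).
Local Notation br := (@dorfman R n M E).

Lemma dorfman_sym (a b : sect E) : br a b + br b a = cD E (ip a b).
Proof.
have S s : br s s = cD E (smooth_half M * ip s s).
  by rewrite courant_symmetric cD_half.
apply: (addIr (br b b)); apply: (addrI (br a a)).
have -> : br a a + (br a b + br b a + br b b) = br (a + b) (a + b).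
  rewrite !(rbilinearDl (courant_bilinear E)) !addrA.
  by rewrite !(rbilinearDr (courant_bilinear E)) !addrA.
rewrite !S -!cDD innerDl !innerDr (innerC _ b a).
by rewrite -{3}(smooth_halfD (ip a b)); congr (cD E _); ring.
Qed.

Lemma dorfman_inner (p a b : sect E) :
  anchor_der (canchor E) p (ip a b) = ip (br p a) b + ip a (br p b).
Proof.
have inv := courant_invariance (c := E) p.
apply: smooth_double_inj; have := inv (a + b).
rewrite !innerDl !innerDr !(rbilinearDr (courant_bilinear E)) !innerDl.
rewrite !anchor_derDr !inv.
rewrite (innerC _ b a) (innerC _ a (br p b)) => H.
apply: (addrI (2%:R * ip (br p a) a + 2%:R * ip (br p b) b)).
transitivity (2%:R * ip (br p a) a + anchor_der (canchor E) p (ip a b) +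
     (anchor_der (canchor E) p (ip a b) + 2%:R * ip (br p b) b)); first by ring.
by rewrite H; ring.
Qed.

End Courant.

Section Twist.
Variables (E V : courant_data M).
Variable nabla : sect E -> sect V -> sect V.
Local Notation ip := (inner (cmetric V)).

(** The map S (or T, with the bundles exchanged) of the introduction. It is locked
so that the additivity of the inner product does not split it into its two
summands. *)
Definition twist (u v : sect V) : sect E :=
  locked (skew_map (cmetric E) (cmetric V) nabla u v
          + smooth_half M *: cD E (ip u v)).

Lemma twistE u v :
  twist u v =
  skew_map (cmetric E) (cmetric V) nabla u v + smooth_half M *: cD E (ip u v).
Proof. by rewrite /twist -lock. Qed.

Hypothesis nabla_conn : is_connection (canchor E) nabla.
Hypothesis nabla_metric : preserves_metric (canchor E) (cmetric V) nabla.

Let nabla_bil : rbilinear nabla. Proof. by case: nabla_conn. Qed.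

(** The derivative of <u, v> along c, halved, adds the missing halves to the skew map
because the connection preserves the metric. *)
Lemma inner_twist c u v :
  inner (cmetric E) c (twist u v) = ip (nabla c u) v.
Proof.
have [_ nablaZ _] := nabla_conn.
rewrite twistE innerDr innerZr inner_cD nabla_metric inner_dual_sect.
  rewrite -[RHS]smooth_halfD; ring.
move=> f s t; rewrite !(rbilinearDl nabla_bil) !nablaZ.
by rewrite !innerDl !innerDr innerZl innerZr; ring.
Qed.

Lemma twistDl u u' v : twist (u + u') v = twist u v + twist u' v.
Proof.
apply: (inner_nondeg (g := cmetric E)) => c.
by rewrite innerDr !inner_twist (rbilinearDr nabla_bil) innerDl.
Qed.

Lemma twistDr u v v' : twist u (v + v') = twist u v + twist u v'.
Proof.
apply: (inner_nondeg (g := cmetric E)) => c.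
by rewrite innerDr !inner_twist innerDr.
Qed.

Lemma twistZr f u v : twist u (f *: v) = f *: twist u v.
Proof.
apply: (inner_nondeg (g := cmetric E)) => c.
by rewrite innerZr !inner_twist innerZr.
Qed.

Lemma twist0l v : twist 0 v = 0.
Proof. by apply: (addIr (twist 0 v)); rewrite -twistDl !add0r. Qed.

Lemma twist0r u : twist u 0 = 0.
Proof. by apply: (addIr (twist u 0)); rewrite -twistDr !add0r. Qed.

Lemma twistNl u v : twist (- u) v = - twist u v.
Proof. by apply/eqP; rewrite -addr_eq0 -twistDl addNr twist0l. Qed.

Lemma twistNr u v : twist u (- v) = - twist u v.
Proof. by apply/eqP; rewrite -addr_eq0 -twistDr addNr twist0r. Qed.

Lemma twist_sym u v : twist u v + twist v u = cD E (ip u v).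
Proof.
apply: (inner_nondeg (g := cmetric E)) => c.
by rewrite innerDr !inner_twist inner_cD nabla_metric (innerC _ (nabla c v)).
Qed.

End Twist.
End SectionCalculus.

(** * The bracket on pairs of sections and its Jacobi defect *)

Section SumBracket.
Variables (R : realType) (n : nat) (M : manifold R n).
Variables (E1 E2 : courant_algebroid M).
Variables (nablar : sect E1 -> sect E2 -> sect E2).
Variables (nablal : sect E2 -> sect E1 -> sect E1).
Local Notation pairs := (sect E1 * sect E2)%type.
Local Notation br1 := (@dorfman R n M E1).
Local Notation br2 := (@dorfman R n M E2).
Local Notation ip1 := (inner (cmetric E1)).
Local Notation ip2 := (inner (cmetric E2)).
Local Notation D1 := (cD E1).
Local Notation D2 := (cD E2).

Local Notation S := (twist (E := E1) (V := E2) nablar).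
Local Notation T := (twist (E := E2) (V := E1) nablal).

(** Working with pairs of sections instead of sections of the sum bundle makes the
exchange of E1 and E2 definitional, see [jacobiator_swap]. *)
Definition pair_bracket (p q : pairs) : pairs :=
  (br1 p.1 q.1 + nablal p.2 q.1 - nablal q.2 p.1 + S p.2 q.2,
   br2 p.2 q.2 + nablar p.1 q.2 - nablar q.1 p.2 + T p.1 q.1).

Definition pair_inner (p q : pairs) : smooth_fun M :=
  ip1 p.1 q.1 + ip2 p.2 q.2.

Definition pair_der (p : pairs) (f : smooth_fun M) : smooth_fun M :=
  anchor_der (canchor E1) p.1 f + anchor_der (canchor E2) p.2 f.

Definition jacobiator (p q r : pairs) : pairs :=
  pair_bracket p (pair_bracket q r) - pair_bracket (pair_bracket p q) r
    - pair_bracket q (pair_bracket p r).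

Hypothesis nablar_conn : is_connection (canchor E1) nablar.
Hypothesis nablal_conn : is_connection (canchor E2) nablal.
Hypothesis nablar_metric : preserves_metric (canchor E1) (cmetric E2) nablar.
Hypothesis nablal_metric : preserves_metric (canchor E2) (cmetric E1) nablal.

Let br1L := courant_bilinear E1.
Let br2L := courant_bilinear E2.
Let nrL : rbilinear nablar. Proof. by case: nablar_conn. Qed.
Let nlL : rbilinear nablal. Proof. by case: nablal_conn. Qed.

Let addl := (rbilinearDl br1L, rbilinearDl br2L, rbilinearDl nrL,
  rbilinearDl nlL, twistDl nablar_conn nablar_metric,
  twistDl nablal_conn nablal_metric).
Let addr := (rbilinearDr br1L, rbilinearDr br2L, rbilinearDr nrL,
  rbilinearDr nlL, twistDr nablar_conn nablar_metric,
  twistDr nablal_conn nablal_metric).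
Let zero := (rbilinear0l br1L, rbilinear0l br2L, rbilinear0l nrL,
  rbilinear0l nlL, twist0l nablar_conn nablar_metric,
  twist0l nablal_conn nablal_metric, rbilinear0r br1L, rbilinear0r br2L,
  rbilinear0r nrL, rbilinear0r nlL, twist0r nablar_conn nablar_metric,
  twist0r nablal_conn nablal_metric, (oppr0, addr0, add0r)).
Let opp := (rbilinearNl br1L, rbilinearNl br2L, rbilinearNl nrL,
  rbilinearNl nlL, twistNl nablar_conn nablar_metric,
  twistNl nablal_conn nablal_metric, rbilinearNr br1L, rbilinearNr br2L,
  rbilinearNr nrL, rbilinearNr nlL, twistNr nablar_conn nablar_metric,
  twistNr nablal_conn nablal_metric).

Lemma pair_inner_nondeg (p q : pairs) :
  (forall r, pair_inner r p = pair_inner r q) -> p = q.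
Proof.
case: p q => [a al] [b be] pq; congr pair.
- apply: (inner_nondeg (g := cmetric E1)) => c.
  by have := pq (c, 0); rewrite /pair_inner /= !inner0l !addr0.
- apply: (inner_nondeg (g := cmetric E2)) => c.
  by have := pq (0, c); rewrite /pair_inner /= !inner0l !add0r.
Qed.

Lemma pair_bracketDl p p' q :
  pair_bracket (p + p') q = pair_bracket p q + pair_bracket p' q.
Proof.
by congr pair; [apply: (inner_nondeg (g := cmetric E1))|
  apply: (inner_nondeg (g := cmetric E2))] => c;
  rewrite /= !(addl, addr) !(innerDr, innerNr); ring.
Qed.

Lemma pair_bracketDr p q q' :
  pair_bracket p (q + q') = pair_bracket p q + pair_bracket p q'.
Proof.
by congr pair; [apply: (inner_nondeg (g := cmetric E1))|
  apply: (inner_nondeg (g := cmetric E2))] => c;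
  rewrite /= !(addl, addr) !(innerDr, innerNr); ring.
Qed.

Lemma pair_bracket0l q : pair_bracket 0 q = 0.
Proof. by rewrite /pair_bracket /= !zero. Qed.

Lemma pair_bracket0r p : pair_bracket p 0 = 0.
Proof. by rewrite /pair_bracket /= !zero. Qed.

Lemma pair_bracket_leibniz p (q : pairs) f :
  pair_bracket p (f *: q.1, f *: q.2) =
  (pair_der p f *: q.1 + f *: (pair_bracket p q).1,
   pair_der p f *: q.2 + f *: (pair_bracket p q).2).
Proof.
have [_ nrZl nrZr] := nablar_conn; have [_ nlZl nlZr] := nablal_conn.
rewrite /pair_bracket /pair_der /=; congr pair.
- apply: (inner_nondeg (g := cmetric E1)) => c.
  rewrite courant_leibniz nlZl nlZr (twistZr nablar_conn nablar_metric).
  by rewrite !(innerDr, innerNr, innerZr); ring.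
- apply: (inner_nondeg (g := cmetric E2)) => c.
  rewrite courant_leibniz nrZl nrZr (twistZr nablal_conn nablal_metric).
  by rewrite !(innerDr, innerNr, innerZr); ring.
Qed.

(** The terms with a connection cancel in the symmetrization, and the symmetric
parts of the two Courant brackets and of S and T are all of the form D<., .>. *)
Lemma pair_bracket_sym p q :
  pair_bracket p q + pair_bracket q p =
  (D1 (pair_inner p q), D2 (pair_inner p q)).
Proof.
rewrite /pair_inner !cDD -!dorfman_sym.
rewrite -(twist_sym nablar_conn nablar_metric).
rewrite -(twist_sym nablal_conn nablal_metric).
by congr pair; [apply: (inner_nondeg (g := cmetric E1))|
  apply: (inner_nondeg (g := cmetric E2))] => c;
  rewrite /= !(innerDr, innerNr); ring.
Qed.

(** The cross terms cancel: <S(al, be), c> equals <nablar_c al, be>, which occurs with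
the opposite sign in the E2-component of the bracket, and symmetrically. *)
Lemma pair_bracket_inner p q r :
  pair_der p (pair_inner q r) =
  pair_inner (pair_bracket p q) r + pair_inner q (pair_bracket p r).
Proof.
rewrite /pair_der /pair_inner /= !anchor_derDr.
rewrite !dorfman_inner nablar_metric nablal_metric.
rewrite !(innerDl, innerDr, innerNl, innerNr).
rewrite (innerC _ (S _ _)) (innerC _ (T _ _)).
rewrite !(inner_twist nablar_conn nablar_metric).
rewrite !(inner_twist nablal_conn nablal_metric).
rewrite (innerC _ q.1 (nablal r.2 _)) (innerC _ q.2 (nablar r.1 _)).
by ring.
Qed.

Lemma pair_innerNl p q : pair_inner (- p) q = - pair_inner p q.
Proof. by rewrite /pair_inner /= !innerNl opprD. Qed.

Lemma pair_innerDl p q r :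
  pair_inner (p + q) r = pair_inner p r + pair_inner q r.
Proof. by rewrite /pair_inner /= !innerDl addrACA. Qed.

Lemma pair_innerC p q : pair_inner p q = pair_inner q p.
Proof. by rewrite /pair_inner innerC (innerC _ p.2). Qed.

Lemma pair_innerDr p q r :
  pair_inner p (q + r) = pair_inner p q + pair_inner p r.
Proof. by rewrite !(pair_innerC p) pair_innerDl. Qed.

Lemma pair_innerNr p q : pair_inner p (- q) = - pair_inner p q.
Proof. by rewrite !(pair_innerC p) pair_innerNl. Qed.

Lemma pair_bracketNl p q : pair_bracket (- p) q = - pair_bracket p q.
Proof.
by apply/eqP; rewrite -addr_eq0 -pair_bracketDl addNr pair_bracket0l.
Qed.

Lemma jacobiatorDl p p' q r :
  jacobiator (p + p') q r = jacobiator p q r + jacobiator p' q r.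
Proof.
rewrite /jacobiator !(pair_bracketDl, pair_bracketDr).
by apply: pair_inner_nondeg => c; rewrite !(pair_innerDr, pair_innerNr); ring.
Qed.

Lemma jacobiatorDm p q q' r :
  jacobiator p (q + q') r = jacobiator p q r + jacobiator p q' r.
Proof.
rewrite /jacobiator !(pair_bracketDl, pair_bracketDr).
by apply: pair_inner_nondeg => c; rewrite !(pair_innerDr, pair_innerNr); ring.
Qed.

Lemma jacobiatorDr p q r r' :
  jacobiator p q (r + r') = jacobiator p q r + jacobiator p q r'.
Proof.
rewrite /jacobiator !(pair_bracketDl, pair_bracketDr).
by apply: pair_inner_nondeg => c; rewrite !(pair_innerDr, pair_innerNr); ring.
Qed.

(** Without orthogonality, J(p, q, r) + J(q, p, r) is minus the bracket of D<p, q>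
with r, by the symmetric part. *)
Lemma jacobiator_swapl p q r : pair_inner p q = 0 ->
  jacobiator q p r = - jacobiator p q r.
Proof.
move=> pq0; have pq : pair_bracket q p = - pair_bracket p q.
  by apply/eqP; rewrite -addr_eq0 pair_bracket_sym pair_innerC pq0 !cD0.
rewrite /jacobiator pq pair_bracketNl.
by apply: pair_inner_nondeg => c; rewrite !(pair_innerDr, pair_innerNr); ring.
Qed.

(** Without orthogonality, J(p, q, r) + J(p, r, q) is p . D<q, r> - D(rho(p)<q, r>),
by the symmetric part and the invariance of the metric. *)
Lemma jacobiator_swapr p q r : pair_inner q r = 0 ->
  jacobiator p r q = - jacobiator p q r.
Proof.
move=> qr0; apply/eqP; rewrite -addr_eq0; apply/eqP.
have -> : jacobiator p r q + jacobiator p q r =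
    pair_bracket p (pair_bracket r q + pair_bracket q r)
    - (pair_bracket (pair_bracket p r) q + pair_bracket q (pair_bracket p r))
    - (pair_bracket (pair_bracket p q) r + pair_bracket r (pair_bracket p q)).
  rewrite /jacobiator pair_bracketDr.
  by apply: pair_inner_nondeg => c; rewrite !(pair_innerDr, pair_innerNr); ring.
have pr : pair_inner (pair_bracket p r) q = - pair_inner (pair_bracket p q) r.
  apply/eqP; rewrite -addr_eq0 pair_innerC addrC -pair_bracket_inner qr0.
  by rewrite /pair_der !anchor_der0r addr0.
rewrite !pair_bracket_sym (pair_innerC r q) qr0 pr !cD0 pair_bracket0r !cDN.
by congr pair; rewrite /= sub0r opprK subrr.
Qed.

(** Moving the brackets across the inner product gives the right-hand side, derivatives
of <r, s>, and the terms rho(p)<r, qs> and rho(q)<r, ps>, each of which occurs twice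
with opposite signs. *)
Lemma jacobiator_inner p q r s : pair_inner r s = 0 ->
  pair_inner (jacobiator p q r) s = - pair_inner r (jacobiator p q s).
Proof.
move=> rs0.
have br0 x y z : pair_inner (pair_bracket x y) z =
    pair_der x (pair_inner y z) - pair_inner y (pair_bracket x z).
  by rewrite pair_bracket_inner addrK.
rewrite /jacobiator !(pair_innerDr, pair_innerNr, pair_innerDl, pair_innerNl).
rewrite !br0 rs0 /pair_der !anchor_der0r addr0 !sub0r !anchor_derNr.
by ring.
Qed.

(** Digits in the names below record, for each of the three arguments, whether it is
taken in E1 or in E2; the suffix [_fst] or [_snd] is the component considered. *)
Lemma jacobiator211_fst al a1 a2 :
  (jacobiator (0, al) (a1, 0) (a2, 0)).1 =
  nablal al (br1 a1 a2) - br1 (nablal al a1) a2 - br1 a1 (nablal al a2)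
    - nablal (nablar a2 al) a1 + nablal (nablar a1 al) a2 + S al (T a1 a2).
Proof.
rewrite /jacobiator /pair_bracket /= !(opp, zero).
apply: (inner_nondeg (g := cmetric E1)) => c.
by rewrite !(innerDr, innerNr); ring.
Qed.

Lemma jacobiator211_snd al a1 a2 be :
  ip2 (jacobiator (0, al) (a1, 0) (a2, 0)).2 be =
  ip2 (curvature nablar a1 a2 al) be + ip1 (curvature nablal al be a1) a2.
Proof.
rewrite /jacobiator /pair_bracket /curvature /= !(opp, zero).
have TE u v w : ip2 (T u v) w = ip1 (nablal w u) v.
  by rewrite innerC (inner_twist nablal_conn nablal_metric).
(* <al . T, be> = rho(al)<T, be> - <T, al . be> with <T, be> = <nablal_be a1, a2>;
   the first term splits because nablal preserves the metric *)
have brT := dorfman_inner al (T a1 a2) be.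
rewrite !TE nablal_metric in brT.
rewrite !(innerDl, innerNl) !TE.
have -> : ip2 (br2 al (T a1 a2)) be = ip1 (nablal al (nablal be a1)) a2 +
    ip1 (nablal be a1) (nablal al a2) - ip1 (nablal (br2 al be) a1) a2.
  by rewrite brT addrK.
by ring.
Qed.

Lemma jacobiator111_fst a1 a2 a3 :
  (jacobiator (a1, 0) (a2, 0) (a3, 0)).1 =
  - (nablal (T a1 a2) a3 + nablal (T a2 a3) a1 - nablal (T a1 a3) a2).
Proof.
rewrite /jacobiator /pair_bracket /= !(opp, zero).
apply: (inner_nondeg (g := cmetric E1)) => c.
by rewrite (courant_jacobi (c := E1)) !(innerDr, innerNr); ring.
Qed.

Lemma pair_split (p : pairs) : p = (p.1, 0) + (0, p.2).
Proof. by case: p => a al; congr pair; rewrite /= ?addr0 ?add0r. Qed.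

Lemma pair_inner12 a al : pair_inner (a, 0) (0, al) = 0.
Proof. by rewrite /pair_inner /= inner0r inner0l addr0. Qed.

Lemma pair_inner21 a al : pair_inner (0, al) (a, 0) = 0.
Proof. by rewrite pair_innerC pair_inner12. Qed.

(** The mixed types not listed differ from the listed ones by transpositions of
adjacent arguments from different summands, which are orthogonal. *)
Lemma jacobiator_eq0_split :
  (forall p q r, jacobiator p q r = 0) <->
  [/\ forall a1 a2 a3, jacobiator (a1, 0) (a2, 0) (a3, 0) = 0,
      forall al a1 a2, jacobiator (0, al) (a1, 0) (a2, 0) = 0,
      forall al1 al2 al3, jacobiator (0, al1) (0, al2) (0, al3) = 0 &
      forall a al1 al2, jacobiator (a, 0) (0, al1) (0, al2) = 0].
Proof.
split=> [J0|[J111 J211 J222 J122] p q r]; first by split=> *; exact: J0.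
have J121 a1 al a2 : jacobiator (a1, 0) (0, al) (a2, 0) = 0.
  by rewrite (jacobiator_swapl _ (pair_inner21 _ _)) J211 oppr0.
have J112 a1 a2 al : jacobiator (a1, 0) (a2, 0) (0, al) = 0.
  by rewrite (jacobiator_swapr _ (pair_inner21 _ _)) J121 oppr0.
have J212 al1 a al2 : jacobiator (0, al1) (a, 0) (0, al2) = 0.
  by rewrite (jacobiator_swapl _ (pair_inner12 _ _)) J122 oppr0.
have J221 al1 al2 a : jacobiator (0, al1) (0, al2) (a, 0) = 0.
  by rewrite (jacobiator_swapr _ (pair_inner12 _ _)) J212 oppr0.
rewrite (pair_split p) (pair_split q) (pair_split r).
rewrite !(jacobiatorDl, jacobiatorDm, jacobiatorDr).
by rewrite J111 J211 J222 J122 J121 J112 J212 J221 !addr0.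
Qed.

Lemma jacobiator211_eq0 :
  (forall al a1 a2, jacobiator (0, al) (a1, 0) (a2, 0) = 0) <->
  (forall al a1 a2,
     nablal al (br1 a1 a2) - br1 (nablal al a1) a2 - br1 a1 (nablal al a2)
       - nablal (nablar a2 al) a1 + nablal (nablar a1 al) a2
     = - S al (T a1 a2)) /\
  (forall a b al be, ip2 (curvature nablar a b al) be
     + ip1 (curvature nablal al be a) b = 0).
Proof.
split=> [J0|[eq1 eq3] al a1 a2].
  split=> [al a1 a2|a b al be].
    by apply/eqP; rewrite -addr_eq0 -jacobiator211_fst J0.
  by rewrite -jacobiator211_snd J0 inner0l.
apply: pair_inner_nondeg => -[b be]; rewrite pair_innerC (pair_innerC _ 0).
rewrite /pair_inner jacobiator211_fst eq1 addNr jacobiator211_snd eq3.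
by rewrite !inner0l.
Qed.

Hypothesis nablalD : forall f b, nablal (D2 f) b = 0.

(** With nablal_{D2 f} = 0, the connection along T(a, b) is the connection along
Omega(a, b) and is skew in a and b. This turns the E1-component of J(a1, a2, a3)
into a cyclic sum; its E2-component is controlled by the mixed types through
[jacobiator_inner]. *)
Lemma jacobiator111_eq0 :
  (forall al a1 a2, jacobiator (0, al) (a1, 0) (a2, 0) = 0) ->
  (forall a1 a2 a3, jacobiator (a1, 0) (a2, 0) (a3, 0) = 0) <->
  (forall a1 a2 a3, nablal (Omega nablal a1 a2) a3
     + nablal (Omega nablal a2 a3) a1 + nablal (Omega nablal a3 a1) a2 = 0).
Proof.
move=> J211.
have TO a b : nablal (T a b) =1 nablal (Omega nablal a b).
  by move=> c; rewrite twistE rbilinearDl// -cD_half nablalD addr0.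
have Ts a b c : nablal (T a b) c = - nablal (T b a) c.
  apply/eqP; rewrite -addr_eq0 -rbilinearDl//.
  by rewrite (twist_sym nablal_conn nablal_metric) nablalD.
have J1 a1 a2 a3 : (jacobiator (a1, 0) (a2, 0) (a3, 0)).1 =
    - (nablal (Omega nablal a1 a2) a3 + nablal (Omega nablal a2 a3) a1
       + nablal (Omega nablal a3 a1) a2).
  by rewrite jacobiator111_fst (Ts a1 a3) opprK !TO.
split=> [J0 a1 a2 a3|eq4 a1 a2 a3].
  by apply: oppr_inj; rewrite -J1 J0 oppr0.
have J2 : (jacobiator (a1, 0) (a2, 0) (a3, 0)).2 = 0.
  apply: (inner_nondeg (g := cmetric E2)) => be; rewrite inner0r innerC.
  have := jacobiator_inner (a1, 0) (a2, 0) (pair_inner12 a3 be).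
  rewrite (jacobiator_swapr _ (pair_inner21 _ _)).
  rewrite (jacobiator_swapl _ (pair_inner21 _ _)) J211 !oppr0.
  by rewrite /pair_inner /= !inner0r add0r addr0 oppr0.
move: J2 (J1 a1 a2 a3); rewrite eq4 oppr0.
by case: (jacobiator _ _ _) => x y /= -> ->.
Qed.

End SumBracket.

(** * The sum of two Courant algebroids *)

Section Conclusion.
Variables (R : realType) (n : nat) (M : manifold R n).
Variables (E1 E2 : courant_algebroid M).
Variables (nablar : sect E1 -> sect E2 -> sect E2).
Variables (nablal : sect E2 -> sect E1 -> sect E1).

Lemma jacobiator_swap p q r :
  jacobiator nablal nablar (p.2, p.1) (q.2, q.1) (r.2, r.1) =
  ((jacobiator nablar nablal p q r).2, (jacobiator nablar nablal p q r).1).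
Proof. by []. Qed.

Lemma jacobiator_swap_eq0 p q r :
  jacobiator nablal nablar (p.2, p.1) (q.2, q.1) (r.2, r.1) = 0 <->
  jacobiator nablar nablal p q r = 0.
Proof.
rewrite jacobiator_swap; case: (jacobiator _ _ _ _ _) => x y.
by split=> -[-> ->].
Qed.

Local Notation E := (courant_sum nablar nablal).

Definition sect_split (phi : sect E) : sect E1 * sect E2 :=
  (sect_fst phi, sect_snd phi).

Definition sect_join (p : sect E1 * sect E2) : sect E := sect_pair p.1 p.2.

Lemma sect_splitK : cancel sect_split sect_join.
Proof.
by move=> phi; apply: sect_eqP => x; rewrite /= -surjective_pairing.
Qed.

Lemma sect_joinK : cancel sect_join sect_split.
Proof. by case=> a al; congr pair; apply: sect_eqP. Qed.

Lemma sect_joinD p q : sect_join (p + q) = sect_join p + sect_join q.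
Proof. exact: sect_eqP. Qed.

Lemma sect_joinZ f p : sect_join (f *: p.1, f *: p.2) = f *: sect_join p.
Proof. exact: sect_eqP. Qed.

Lemma sum_dorfmanE phi psi : dorfman (c := E) phi psi =
  sect_join (pair_bracket nablar nablal (sect_split phi) (sect_split psi)).
Proof.
by congr sect_pair; rewrite /= twistE !addrA.
Qed.

Lemma sum_innerE phi psi : inner (cmetric E) phi psi =
  pair_inner (sect_split phi) (sect_split psi).
Proof. exact: smooth_fun_eqP. Qed.

Lemma sum_anchorE phi f : anchor_der (canchor E) phi f =
  pair_der (sect_split phi) f.
Proof. exact: smooth_fun_eqP. Qed.

Lemma sum_cDE f : cD E f = sect_join (cD E1 f, cD E2 f).
Proof.
apply: (inner_nondeg (g := cmetric E)) => c.
by rewrite inner_cD sum_anchorE sum_innerE sect_joinK /pair_inner !inner_cD.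
Qed.

Lemma sum_jacobiE :
  jacobi_identity E <-> forall p q r, jacobiator nablar nablal p q r = 0.
Proof.
have J phi psi1 psi2 :
    dorfman (c := E) phi (dorfman psi1 psi2) =
      dorfman (dorfman phi psi1) psi2 + dorfman psi1 (dorfman phi psi2) <->
    jacobiator nablar nablal (sect_split phi) (sect_split psi1)
      (sect_split psi2) = 0.
  rewrite !sum_dorfmanE !sect_joinK -sect_joinD /jacobiator -addrA -opprD.
  split=> [/(can_inj sect_joinK) ->|/eqP]; first by rewrite subrr.
  by rewrite subr_eq0 => /eqP ->.
split=> [JE p q r|J0 phi psi1 psi2]; last exact/J.
by rewrite -(sect_joinK p) -(sect_joinK q) -(sect_joinK r); apply/J.
Qed.

End Conclusion.

Theorem proposition4p8 (R : realType) (n : nat) (M : manifold R n)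
    (E1 E2 : courant_algebroid M)
    (nablar : sect E1 -> sect E2 -> sect E2)
    (nablal : sect E2 -> sect E1 -> sect E1)
    (nablar_conn : is_connection (canchor E1) nablar)
    (nablal_conn : is_connection (canchor E2) nablal)
    (nablar_metric : preserves_metric (canchor E1) (cmetric E2) nablar)
    (nablal_metric : preserves_metric (canchor E2) (cmetric E1) nablal)
    (nablarD : forall (f : smooth_fun M) (beta : sect E2),
       nablar (cD E1 f) beta = 0)
    (nablalD : forall (f : smooth_fun M) (b : sect E1),
       nablal (cD E2 f) b = 0) :
  let E : courant_data M := courant_sum nablar nablal in
  let ip1 : sect E1 -> sect E1 -> smooth_fun M := inner (cmetric E1) in
  let ip2 : sect E2 -> sect E2 -> smooth_fun M := inner (cmetric E2) in
  let br1 : sect E1 -> sect E1 -> sect E1 := @dorfman R n M E1 in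
  let br2 : sect E2 -> sect E2 -> sect E2 := @dorfman R n M E2 in
  let D1 : smooth_fun M -> sect E1 := cD E1 in
  let D2 : smooth_fun M -> sect E2 := cD E2 in
  let Om : sect E1 -> sect E1 -> sect E2 := Omega nablal in
  let Mh : sect E2 -> sect E2 -> sect E1 := Mho nablar in
  let h : smooth_fun M := smooth_half M in
  [/\ leibniz_rule E,
      symmetric_part E,
      metric_invariance E &
      (jacobi_identity E <->
      [/\ (forall (alpha : sect E2) (a1 a2 : sect E1),
             nablal alpha (br1 a1 a2) - br1 (nablal alpha a1) a2
               - br1 a1 (nablal alpha a2)
               - nablal (nablar a2 alpha) a1 + nablal (nablar a1 alpha) a2
             = - Mh alpha (Om a1 a2 + h *: D2 (ip1 a1 a2))
               - h *: D1 (ip2 alpha (Om a1 a2 + h *: D2 (ip1 a1 a2)))),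
          (forall (a : sect E1) (alpha1 alpha2 : sect E2),
             nablar a (br2 alpha1 alpha2) - br2 (nablar a alpha1) alpha2
               - br2 alpha1 (nablar a alpha2)
               - nablar (nablal alpha2 a) alpha1
               + nablar (nablal alpha1 a) alpha2
             = - Om a (Mh alpha1 alpha2 + h *: D1 (ip2 alpha1 alpha2))
               - h *: D2 (ip1 a (Mh alpha1 alpha2
                                   + h *: D1 (ip2 alpha1 alpha2)))),
          (forall (a b : sect E1) (alpha beta : sect E2),
             ip2 (curvature nablar a b alpha) beta
               + ip1 (curvature nablal alpha beta a) b = 0),
          (forall a1 a2 a3 : sect E1,
             nablal (Om a1 a2) a3 + nablal (Om a2 a3) a1
               + nablal (Om a3 a1) a2 = 0) &
          (forall alpha1 alpha2 alpha3 : sect E2,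
             nablar (Mh alpha1 alpha2) alpha3 + nablar (Mh alpha2 alpha3) alpha1
               + nablar (Mh alpha3 alpha1) alpha2 = 0)])].

Proof.
move=> E ip1 ip2 br1 br2 D1 D2 Om Mh h.
have L := pair_bracket_leibniz
  nablar_conn nablal_conn nablar_metric nablal_metric.
have Sy := pair_bracket_sym
  nablar_conn nablal_conn nablar_metric nablal_metric.
have I := pair_bracket_inner
  nablar_conn nablal_conn nablar_metric nablal_metric.
(* J122 and J222 are stated for the data with E1 and E2 exchanged *)
have J211 := jacobiator211_eq0
  nablar_conn nablal_conn nablar_metric nablal_metric.
have J122 := jacobiator211_eq0
  nablal_conn nablar_conn nablal_metric nablar_metric.
have J111 := jacobiator111_eq0
  nablar_conn nablal_conn nablar_metric nablal_metric nablalD.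
have J222 := jacobiator111_eq0
  nablal_conn nablar_conn nablal_metric nablar_metric nablarD.
have rhs1 al a1 a2 : - twist nablar al (twist nablal a1 a2) =
    - Mh al (Om a1 a2 + h *: D2 (ip1 a1 a2))
      - h *: D1 (ip2 al (Om a1 a2 + h *: D2 (ip1 a1 a2))).
  by rewrite !twistE opprD.
have rhs2 a al1 al2 : - twist nablal a (twist nablar al1 al2) =
    - Om a (Mh al1 al2 + h *: D1 (ip2 al1 al2))
      - h *: D2 (ip1 a (Mh al1 al2 + h *: D1 (ip2 al1 al2))).
  by rewrite !twistE opprD.
split.
- move=> phi psi f; rewrite !sum_dorfmanE sum_anchorE.
  have -> : sect_split (f *: psi) =
      (f *: (sect_split psi).1, f *: (sect_split psi).2).
    by rewrite -[psi in LHS]sect_splitK -sect_joinZ sect_joinK.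
  by rewrite L -[X in _ = _ *: X + _]sect_splitK -!sect_joinZ -sect_joinD.
- move=> phi; rewrite sum_dorfmanE sum_cDE sum_innerE -Sy sect_joinD.
  rewrite scalerDr -scalerDl.
  by rewrite -[X in X + X]mulr1 smooth_halfD scale1r.
- move=> phi psi; rewrite sum_anchorE !sum_innerE I sum_dorfmanE sect_joinK.
  by rewrite (pair_innerC (sect_split psi)) mulr_natl mulr2n.
rewrite sum_jacobiE jacobiator_eq0_split//.
split=> [[J0111 J0211 J0222 J0122]|[eq1 eq2 eq3 eq4 eq5]].
  have {}J0122 a al1 al2 :
      jacobiator nablal nablar (0, a) (al1, 0) (al2, 0) = 0.
    exact/(jacobiator_swap_eq0 _ _ (a, 0) (0, al1) (0, al2))/J0122.
  have {}J0222 al1 al2 al3 :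
      jacobiator nablal nablar (al1, 0) (al2, 0) (al3, 0) = 0.
    exact/(jacobiator_swap_eq0 _ _ (0, al1) (0, al2) (0, al3))/J0222.
  have [eq1 eq3] := J211.1 J0211; have [eq2 _] := J122.1 J0122.
  split=> //.
  - by move=> *; rewrite eq1 rhs1.
  - by move=> *; rewrite eq2 rhs2.
  - exact/(J111 J0211).
  - exact/(J222 J0122).
have J0211 : forall al a1 a2,
    jacobiator nablar nablal (0, al) (a1, 0) (a2, 0) = 0.
  by apply/J211; split=> // *; rewrite eq1 rhs1.
have J0122 : forall a al1 al2,
    jacobiator nablal nablar (0, a) (al1, 0) (al2, 0) = 0.
  apply/J122; split=> [*|al be a b]; first by rewrite eq2 rhs2.
  by rewrite addrC eq3.
split=> //; first exact/(J111 J0211).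
- move=> al1 al2 al3.
  apply/(jacobiator_swap_eq0 _ _ (0, al1) (0, al2) (0, al3)).
  exact: (J222 J0122).2 eq5 al1 al2 al3.
- by move=> a al1 al2; apply/(jacobiator_swap_eq0 _ _ (a, 0) (0, al1) (0, al2)).
Qed.
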